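(* Given any instance $(\mathcal K=\{K_1,\dots,K_n\},\alpha,\beta)$ of the standard binary-split-tree problem, an optimal binary split tree can be computed in $O(n^4)$ time.
   Context: Keys $K_1<\dots<K_n$ are real numbers; a random query $v\in\mathbb R$ satisfies $\Pr[v=K_i]=\beta_i$ and $\Pr[K_i<v<K_{i+1}]=\alpha_i$ (with $\alpha_0=\Pr[v<K_1]$, $\alpha_n=\Pr[v>K_n]$); in the standard problem queries may be keys or lie in any interval between keys. A binary split tree is a rooted binary tree in which each node $N$ stores an equality key $e_N$ and a split key $s_N$ from $\mathcal K$. A search for $v$ starting at the root halts at node $N$ if $v=e_N$; otherwise it continues in the left subtree if $v<s_N$ and in the right subtree if $v\ge s_N$; searches for non-keys terminate at leaves. The tree must correctly handle all queries (each key is found, and each unsuccessful search determines the interval between consecutive keys containing the query). Moreover, the maximum-likelihood constraint holds: each equality key $e_N$ is a key of maximum probability $\beta$ among the keys whose search reaches $N$. The cost of the tree is the expected number of nodes visited by a random query; an optimal tree has minimum cost. *)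

(* Defs.v *)
From HB Require Import structures.
From mathcomp Require Import all_boot all_order all_algebra.
From mathcomp Require Import all_classical all_reals all_analysis.

Set Implicit Arguments.
Unset Strict Implicit.
Unset Printing Implicit Defensive.

Import Order.TTheory GRing.Theory Num.Theory.
Import numFieldNormedType.Exports.

Local Open Scope classical_set_scope.
Local Open Scope ring_scope.

(** * Binary split trees

    The n keys are K 0 < ... < K (n-1), indexed from 0 by 'I_n.  The n+1
    intervals between keys are indexed by 'I_n.+1: interval i is
    ]K (i-1), K i[, unbounded on the left if i = 0 and on the right if i = n. *)

Definition gap (R : realType) (n : nat) (K : 'I_n -> R) (i : 'I_n.+1) : set R :=
  [set v | (forall j : 'I_n, j.+1 = i :> nat -> K j < v) /\
           (forall j : 'I_n, j = i :> nat -> v < K j)].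

Definition bst_instance (R : realType) (n : nat)
    (K : 'I_n -> R) (alpha : 'I_n.+1 -> R) (beta : 'I_n -> R)
    (d : measure_display) (Omega : measurableType d) (P : probability Omega R)
    (V : {RV P >-> R}) : Prop :=
  [/\ (0 < n)%N,
      forall i j : 'I_n, (i < j)%N -> K i < K j,
      forall i : 'I_n, P (V @^-1` [set K i]) = (beta i)%:E
    & forall i : 'I_n.+1, P (V @^-1` gap K i) = (alpha i)%:E].

(** [Leaf] is an external leaf: it stores no keys and is not a node in the
    sense of [visits] and [max_likelihood]. *)
Inductive split_tree (n : nat) : Type :=
| Leaf
| Node (e s : 'I_n) (l r : split_tree n).

Arguments Leaf {n}.

(** Positions in a tree are sequences of turns from the root:
    [false] for left, [true] for right. *)
Fixpoint subtree (n : nat) (T : split_tree n) (p : seq bool) : split_tree n :=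
  match p, T with
  | b :: p', Node _ _ l r => subtree (if b then r else l) p'
  | _, _ => T
  end.

(** The position at which the search for v ends. *)
Fixpoint search (R : realType) (n : nat) (K : 'I_n -> R)
    (T : split_tree n) (v : R) : seq bool :=
  match T with
  | Leaf => [::]
  | Node e s l r =>
      if v == K e then [::]
      else if v < K s then false :: search K l v else true :: search K r v
  end.

(** The search for v passes through position p (or ends there). *)
Definition reaches (R : realType) (n : nat) (K : 'I_n -> R)
    (T : split_tree n) (v : R) (p : seq bool) : bool :=
  prefix p (search K T v).

Fixpoint visits (R : realType) (n : nat) (K : 'I_n -> R)
    (T : split_tree n) (v : R) : nat :=
  match T with
  | Leaf => 0%N
  | Node e s l r =>
      if v == K e then 1%N
      else if v < K s then (visits K l v).+1 else (visits K r v).+1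
  end.

(** In the second clause, an unsuccessful search determines the interval
    through the leaf at which it ends. *)
Definition handles_all_queries (R : realType) (n : nat) (K : 'I_n -> R)
    (T : split_tree n) : Prop :=
  (forall k : 'I_n, exists s l r, subtree T (search K T (K k)) = Node k s l r) /\
  (forall (i j : 'I_n.+1) (v w : R), gap K i v -> gap K j w ->
     search K T v = search K T w -> i = j).

(** e is itself one of the keys reaching the node, so every node is reached by
    some key.  Ties may be broken arbitrarily and independently at each node. *)
Definition max_likelihood (R : realType) (n : nat) (K : 'I_n -> R)
    (beta : 'I_n -> R) (T : split_tree n) : Prop :=
  forall (p : seq bool) (e s : 'I_n) (l r : split_tree n),
    subtree T p = Node e s l r ->
    reaches K T (K e) p /\
    (forall k : 'I_n, reaches K T (K k) p -> beta k <= beta e).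

Definition binary_split_tree (R : realType) (n : nat) (K : 'I_n -> R)
    (beta : 'I_n -> R) (T : split_tree n) : Prop :=
  handles_all_queries K T /\ max_likelihood K beta T.

Definition cost (R : realType) (n : nat) (K : 'I_n -> R)
    (d : measure_display) (Omega : measurableType d) (P : probability Omega R)
    (V : {RV P >-> R}) (T : split_tree n) : \bar R :=
  ('E_P[fun w => (visits K T (V w))%:R])%E.

Definition optimal (R : realType) (n : nat) (K : 'I_n -> R) (beta : 'I_n -> R)
    (d : measure_display) (Omega : measurableType d) (P : probability Omega R)
    (V : {RV P >-> R}) (T : split_tree n) : Prop :=
  binary_split_tree K beta T /\
  (forall T' : split_tree n, binary_split_tree K beta T' ->
     (cost K V T <= cost K V T')%E).

(** * The machine model

    A unit-cost RAM with two kinds of memory words: natural numbers, used for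
    control and addressing, and real numbers, which can only be copied, added,
    subtracted and compared.  Memory is organised in arrays whose names are
    literals of the program text, so that a program uses finitely many of
    them; a scalar variable is a cell with a literal index. *)

Inductive iexp : Type :=
| IConst (c : nat)
| IGet (a : nat) (i : iexp)
| IAdd (e1 e2 : iexp)
| ISub (e1 e2 : iexp) (* truncated *)
| IMul (e1 e2 : iexp).

Inductive rexp : Type :=
| RGet (a : nat) (i : iexp)
| RAdd (x1 x2 : rexp)
| RSub (x1 x2 : rexp).

Inductive bexp : Type :=
| BLeI (e1 e2 : iexp)
| BLeR (x1 x2 : rexp)
| BNot (b : bexp)
| BAnd (b1 b2 : bexp).

Inductive cmd : Type :=
| Skip
| ISet (a : nat) (i e : iexp)
| RSet (a : nat) (i : iexp) (x : rexp)
| Seq (c1 c2 : cmd)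
| If (b : bexp) (c1 c2 : cmd)
| While (b : bexp) (c : cmd).

Record state (R : realType) : Type := State {
  ints : nat -> nat -> nat;
  reals : nat -> nat -> R
}.

Definition set_cell (X : Type) (m : nat -> nat -> X) (a i : nat) (x : X) :
    nat -> nat -> X :=
  fun a' i' => if (a' == a) && (i' == i) then x else m a' i'.

Fixpoint ieval (R : realType) (st : state R) (e : iexp) : nat :=
  match e with
  | IConst c => c
  | IGet a i => ints st a (ieval st i)
  | IAdd e1 e2 => (ieval st e1 + ieval st e2)%N
  | ISub e1 e2 => (ieval st e1 - ieval st e2)%N
  | IMul e1 e2 => (ieval st e1 * ieval st e2)%N
  end.

Fixpoint reval (R : realType) (st : state R) (x : rexp) : R :=
  match x with
  | RGet a i => reals st a (ieval st i)
  | RAdd x1 x2 => reval st x1 + reval st x2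
  | RSub x1 x2 => reval st x1 - reval st x2
  end.

Fixpoint beval (R : realType) (st : state R) (b : bexp) : bool :=
  match b with
  | BLeI e1 e2 => (ieval st e1 <= ieval st e2)%N
  | BLeR x1 x2 => reval st x1 <= reval st x2
  | BNot b1 => ~~ beval st b1
  | BAnd b1 b2 => beval st b1 && beval st b2
  end.

(** Evaluating an expression takes one step per operation in it. *)

Fixpoint itime (e : iexp) : nat :=
  match e with
  | IConst _ => 1%N
  | IGet _ i => (itime i).+1
  | IAdd e1 e2 | ISub e1 e2 | IMul e1 e2 => (itime e1 + itime e2).+1
  end.

Fixpoint rtime (x : rexp) : nat :=
  match x with
  | RGet _ i => (itime i).+1
  | RAdd x1 x2 | RSub x1 x2 => (rtime x1 + rtime x2).+1
  end.

Fixpoint btime (b : bexp) : nat :=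
  match b with
  | BLeI e1 e2 => (itime e1 + itime e2).+1
  | BLeR x1 x2 => (rtime x1 + rtime x2).+1
  | BNot b1 => (btime b1).+1
  | BAnd b1 b2 => (btime b1 + btime b2).+1
  end.

(** [exec W c st t st']: started in st, the command c halts in st' after t
    steps.  Natural numbers stored in memory must be smaller than W, and
    execution is stuck on an overflow.  With W polynomial in the input size
    this is the usual restriction to words of logarithmic length, without which
    unit-cost multiplication would be unreasonably powerful. *)
Inductive exec (R : realType) (W : nat) :
    cmd -> state R -> nat -> state R -> Prop :=
| ExecSkip st : exec W Skip st 1%N st
| ExecISet a i e st :
    (ieval st e < W)%N ->
    exec W (ISet a i e) st (itime i + itime e).+1
      (State (set_cell (ints st) a (ieval st i) (ieval st e)) (reals st))
| ExecRSet a i x st :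
    exec W (RSet a i x) st (itime i + rtime x).+1
      (State (ints st) (set_cell (reals st) a (ieval st i) (reval st x)))
| ExecSeq c1 c2 st st1 st2 t1 t2 :
    exec W c1 st t1 st1 -> exec W c2 st1 t2 st2 ->
    exec W (Seq c1 c2) st (t1 + t2) st2
| ExecIfTrue b c1 c2 st st' t :
    beval st b -> exec W c1 st t st' ->
    exec W (If b c1 c2) st (btime b + t).+1 st'
| ExecIfFalse b c1 c2 st st' t :
    ~~ beval st b -> exec W c2 st t st' ->
    exec W (If b c1 c2) st (btime b + t).+1 st'
| ExecWhileFalse b c st :
    ~~ beval st b -> exec W (While b c) st (btime b).+1 st
| ExecWhileTrue b c st st1 st2 t1 t2 :
    beval st b -> exec W c st t1 st1 -> exec W (While b c) st1 t2 st2 ->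
    exec W (While b c) st (btime b + t1 + t2).+1 st2.

(** Input: n in cell 0 of integer array 0; K, alpha and beta in the real
    arrays 0, 1 and 2.  All other cells are initially zero. *)
Definition input_array (R : realType) (m : nat) (f : 'I_m -> R) (i : nat) : R :=
  if insub i is Some j then f j else 0.

Definition input (R : realType) (n : nat)
    (K : 'I_n -> R) (alpha : 'I_n.+1 -> R) (beta : 'I_n -> R) : state R :=
  State (fun a i => if (a == 0)%N && (i == 0)%N then n else 0%N)
    (fun a => match a with
              | 0%N => input_array K
              | 1%N => input_array alpha
              | 2%N => input_array beta
              | _ => fun=> 0
              end).

(** Trees are stored by pointers.  The vertex at address p is described by the
    cells p of the integer arrays 1 (0 for a leaf, 1 for a node), 2 (equality
    key), 3 (split key), 4 and 5 (addresses of the left and right child). *)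
Fixpoint tree_at (n : nat) (m : nat -> nat -> nat) (p : nat)
    (T : split_tree n) : Prop :=
  match T with
  | Leaf => m 1%N p = 0%N
  | Node e s l r =>
      [/\ m 1%N p = 1%N, m 2%N p = e & m 3%N p = s] /\
      (tree_at m (m 4%N p) l /\ tree_at m (m 5%N p) r)
  end.

(** Output: cell 1 of integer array 0 is the address of the root. *)
Definition outputs (R : realType) (n : nat) (st : state R)
    (T : split_tree n) : Prop :=
  tree_at (ints st) (ints st 0%N 1%N) T.

(* Main.v *)
Require Import Defs.
From HB Require Import structures.
From mathcomp Require Import all_boot all_order all_algebra.
From mathcomp Require Import all_classical all_reals all_analysis.
From mathcomp Require Import measurable_realfun zify lra.

(** Every node is reached by its own equality key, so nodes and keys are in
    bijection; hence there are n + 1 leaves, one per gap, and every split is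
    proper.  Number the keys from 1 and add a virtual key 0, removed above the
    root, whose weight dominates all others.  Then the subtree that separates
    the gaps of an interval [i, j) still contains all keys of [i, j) except one
    key r of maximum weight, and counting nodes in its two children shows that r
    and the equality key e of its root lie on different sides of the split s.
    Since r and e are two keys of largest weight in [i, j), the least cost F i j
    of such a subtree does not depend on r, even with ties:
      F i j = mass i j - max weight + min_s (F i s + F s j),
    where s ranges over the splits whose two sides have the two largest weights
    of [i, j) as their maxima.  The entries of the table of F are themselves
    the vertices of optimal trees, so nothing has to be reconstructed. *)

Set Implicit Arguments.
Unset Strict Implicit.
Unset Printing Implicit Defensive.

Import Order.TTheory GRing.Theory Num.Theory.

(** * Trees as recursive divisions of intervals of gaps *)

Section Trees.
Local Open Scope ring_scope.
Context {R : realType} {n : nat} (K : 'I_n -> R) (beta : 'I_n -> R).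

(** Relativised to a set of queries so that induction can pass to subtrees, whose searches receive
    only the queries sent there. *)
Definition correct_on (A : pred R) (T : split_tree n) : Prop :=
  [/\ forall k, A (K k) ->
        exists s l r, subtree T (search K T (K k)) = Node k s l r,
      forall i j v w, gap K i v -> gap K j w -> A v -> A w ->
        search K T v = search K T w -> i = j
    & forall p e s l r, subtree T p = Node e s l r ->
        [/\ A (K e), reaches K T (K e) p &
            forall k, A (K k) -> reaches K T (K k) p -> beta k <= beta e]].

Lemma correct_on_predT T :
  correct_on predT T <-> binary_split_tree K beta T.
Proof.
split=> [[keys gaps ml]|[[keys gaps] ml]].
  split; first split=> [k|i j v w gv gw]; first exact: keys.
    exact: gaps.
  by move=> p e s l r /ml[_ re le_e]; split=> // k; apply: le_e.
split=> [k _|i j v w gv gw _ _|p e s l r /ml[re le_e]]; first exact: keys.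
  exact: gaps.
by split=> // k _; apply: le_e.
Qed.

Definition go_left (A : pred R) (e s : 'I_n) : pred R :=
  [pred v | [&& A v, v != K e & v < K s]].
Definition go_right (A : pred R) (e s : 'I_n) : pred R :=
  [pred v | [&& A v, v != K e & K s <= v]].

Lemma search_left A e s l r v : go_left A e s v ->
  search K (Node e s l r) v = false :: search K l v.
Proof. by case/and3P=> _ /negPf /= -> ->. Qed.

Lemma search_right A e s l r v : go_right A e s v ->
  search K (Node e s l r) v = true :: search K r v.
Proof. by case/and3P=> _ /negPf /= ->; rewrite leNgt => /negPf ->. Qed.

Hypothesis K_mono : forall i j : 'I_n, (i < j)%N -> K i < K j.

Lemma ltK i j : (K i < K j) = (i < j)%N.
Proof.
case: (ltngtP i j) => [/K_mono->//|/K_mono lt_ji|/val_inj ->]; last exact: ltxx.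
by apply/negbTE; rewrite -leNgt ltW.
Qed.

Lemma eqK i j : (K i == K j) = (i == j).
Proof.
case: (eqVneq i j) => [->|]; first exact: eqxx.
by move=> ne; apply/negbTE; rewrite neq_lt !ltK -neq_ltn.
Qed.

(** A gap contains no key, so every split sends it to one side as a whole. *)
Lemma gap_ltK g v (s : 'I_n) : gap K g v -> (v < K s) = (g <= s)%N.
Proof.
case=> lo hi; case: leqP => [le_gs|lt_sg].
  have lt_gn : (g < n)%N by apply: leq_ltn_trans le_gs _.
  have := hi (Ordinal lt_gn) erefl; rewrite /= => lt_v.
  case: (ltngtP g s) le_gs => // [lt_gs|eq_gs] _.
    exact: lt_trans lt_v (K_mono _).
  by rewrite (_ : s = Ordinal lt_gn) //; apply: val_inj.
apply/negbTE; rewrite -leNgt.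
have g1n : (g.-1 < n)%N by have := ltn_ord g; lia.
have := lo (Ordinal g1n) => /= /(_ ltac:(lia)) lt_v.
case: (ltngtP s g.-1) => [lt_s||eq_s]; last 2 first.
- lia.
- by rewrite (_ : s = Ordinal g1n) ?ltW //; apply: val_inj.
by apply: ltW; apply: lt_trans lt_v; apply: K_mono.
Qed.

Lemma gap_neqK g v (s : 'I_n) : gap K g v -> v != K s.
Proof.
move=> gv; apply/negP => /eqP def_v; move: (gv); rewrite def_v => -[lo hi].
have := gap_ltK s gv; rewrite def_v ltxx => /esym/negbT; rewrite -ltnNge => lt_sg.
have g1n : (g.-1 < n)%N by have := ltn_ord g; lia.
have := lo (Ordinal g1n) => /= /(_ ltac:(lia)); rewrite ltK /=; lia.
Qed.

Lemma gap_exists g : exists v, gap K g v.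
Proof.
have [g0|g_gt0] := posnP g.
  have [n0|n_gt0] := posnP n.
    exists 0; split=> j; exfalso; have := ltn_ord j; lia.
  exists (K (Ordinal n_gt0) - 1); split=> j; first by rewrite g0.
  rewrite g0 => j0; rewrite (_ : j = Ordinal n_gt0) ?ltrBlDr ?ltrDl //.
  exact: val_inj.
have g1n : (g.-1 < n)%N by have := ltn_ord g; lia.
have eqg j : j.+1 = g -> forall h : (j < n)%N, Ordinal h = Ordinal g1n.
  by move=> eq_jg h; apply: val_inj => /=; lia.
have [gn|gn] := ltnP g n; last first.
  exists (K (Ordinal g1n) + 1); split=> j jg.
    by rewrite (_ : j = Ordinal g1n) ?ltrDl //; apply: val_inj => /=; lia.
  by exfalso; have := ltn_ord j; lia.
exists ((K (Ordinal g1n) + K (Ordinal gn)) / 2).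
have lt_K : K (Ordinal g1n) < K (Ordinal gn) by apply: K_mono => /=; lia.
split=> j jg.
  rewrite (_ : j = Ordinal g1n); last by apply: val_inj => /=; lia.
  lra.
rewrite (_ : j = Ordinal gn); last by apply: val_inj.
lra.
Qed.

Lemma correct_on_leaf A : correct_on A Leaf <->
  (forall k, ~~ A (K k)) /\
  (forall i j v w, gap K i v -> gap K j w -> A v -> A w -> i = j).
Proof.
split=> [[keys gaps ml]|[keys gaps]].
  split=> [k|i j v w gv gw Av Aw]; last exact: gaps gv gw _ _ _.
  by apply/negP => /keys[s [l [r]]].
split=> [k|i j v w gv gw Av Aw _|[|? ?] //].
- by move/negP: (keys k).
- exact: gaps gv gw _ _.
Qed.

(** Searches that part at the root end at different positions, so gaps sent to different sides need
    no comparison; a gap never contains [K e], so each of its points does go to a side. *)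
Lemma correct_on_node A e s l r : correct_on A (Node e s l r) <->
  [/\ A (K e), forall k, A (K k) -> beta k <= beta e,
      correct_on (go_left A e s) l & correct_on (go_right A e s) r].
Proof.
have side v : A v -> v != K e -> go_left A e s v \/ go_right A e s v.
  by move=> Av ne; rewrite /go_left /go_right /= Av ne /= leNgt;
     case: (v < K s); [left|right].
split=> [[keys gaps ml]|[Ae le_e [keysl gapsl mll] [keysr gapsr mlr]]].
  have [Ae _ le_e] := ml [::] e s l r erefl.
  split=> //.
  - by move=> k Ak; apply: le_e => //; rewrite /reaches prefix0s.
  - split=> [k lk|i j v w gv gw lv lw eq_vw|p e' s' l' r' sub_p].
    + have /keys : A (K k) by case/and3P: lk.
      by rewrite (search_left _ _ lk).
    + apply: gaps gv gw _ _ _; try by [case/and3P: lv|case/and3P: lw].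
      by rewrite (search_left _ _ lv) (search_left _ _ lw) eq_vw.
    + have [Ae' re' le_e'] := ml (false :: p) e' s' l' r' sub_p.
      move: re'; rewrite /reaches /=; case: eqVneq => // ne.
      case: ltP => // lt /=;  move=> re'.
      split=> // [|k lk re]; first by rewrite /go_left /= Ae' ne lt.
      apply: le_e'; first by case/and3P: lk.
      by rewrite /reaches (search_left _ _ lk).
  - split=> [k lk|i j v w gv gw lv lw eq_vw|p e' s' l' r' sub_p].
    + have /keys : A (K k) by case/and3P: lk.
      by rewrite (search_right _ _ lk).
    + apply: gaps gv gw _ _ _; try by [case/and3P: lv|case/and3P: lw].
      by rewrite (search_right _ _ lv) (search_right _ _ lw) eq_vw.
    + have [Ae' re' le_e'] := ml (true :: p) e' s' l' r' sub_p.
      move: re'; rewrite /reaches /=; case: eqVneq => // ne.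
      case: ltP => // lt /=;  move=> re'.
      split=> // [|k lk re]; first by rewrite /go_right /= Ae' ne lt.
      apply: le_e'; first by case/and3P: lk.
      by rewrite /reaches (search_right _ _ lk).
split=> [k Ak|i j v w gv gw Av Aw|[|[] p] e' s' l' r' /=].
- case: (eqVneq k e) => [->|ne]; first by exists s, l, r; rewrite /= eqxx.
  have /(side _ Ak)[lk|rk] : K k != K e by rewrite eqK.
    by rewrite (search_left _ _ lk); apply: keysl.
  by rewrite (search_right _ _ rk); apply: keysr.
- have [lv|rv] := side v Av (gap_neqK e gv);
    have [lw|rw] := side w Aw (gap_neqK e gw).
  + by rewrite (search_left _ _ lv) (search_left _ _ lw) => -[]; apply: gapsl.
  + by rewrite (search_left _ _ lv) (search_right _ _ rw).
  + by rewrite (search_right _ _ rv) (search_left _ _ lw).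
  + by rewrite (search_right _ _ rv) (search_right _ _ rw) => -[]; apply: gapsr.
- by case=> <- _ _ _; split=> // [|k Ak _]; [rewrite /reaches prefix0s|apply: le_e].
- move=> /mlr[re' pe' le_e']; split.
  + by case/and3P: re'.
  + by rewrite /reaches (search_right _ _ re').
  + move=> k Ak; rewrite /reaches /=; case: eqVneq => // ne.
    case: ltP => // lt /=;  move=> pk.
    by apply: le_e' => //; rewrite /go_right /= Ak ne lt.
- move=> /mll[re' pe' le_e']; split.
  + by case/and3P: re'.
  + by rewrite /reaches (search_left _ _ re').
  + move=> k Ak; rewrite /reaches /=; case: eqVneq => // ne.
    case: ltP => // lt /=;  move=> pk.
    by apply: le_e' => //; rewrite /go_left /= Ak ne lt.
Qed.

(** All that matters of a query set is an interval of gaps and a set of keys. Keys are shifted by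
    one, which frees index 0 for the virtual key. *)
Definition in_play (A : pred R) (i j : nat) (X : pred nat) : Prop :=
  [/\ forall g v, gap K g v -> A v = (i <= g < j)%N,
      forall k : 'I_n, A (K k) = X k.+1
    & forall k, X k -> (i <= k < j)%N].

(** The [minn] allows for a split outside the interval, since properness is only proved in
    [correct_spans]. *)
Lemma in_play_left A i j X e s : in_play A i j X ->
  in_play (go_left A e s) i (minn s.+1 j)
    [pred k | [&& X k, k != e.+1 & (k < s.+1)%N]].
Proof.
case=> gapsA keysA XA; split=> [g v gv|k|k].
- by rewrite /go_left /= (gapsA _ _ gv) (gap_neqK e gv) (gap_ltK s gv); lia.
- by rewrite /go_left /= keysA eqK ltK eqSS.
- by case/and3P=> /XA; lia.
Qed.

Lemma in_play_right A i j X e s : in_play A i j X ->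
  in_play (go_right A e s) (maxn s.+1 i) j
    [pred k | [&& X k, k != e.+1 & (s.+1 <= k)%N]].
Proof.
case=> gapsA keysA XA; split=> [g v gv|k|k].
- rewrite /go_right /= (gapsA _ _ gv) (gap_neqK e gv) leNgt (gap_ltK s gv).
  by lia.
- by rewrite /go_right /= keysA eqK leNgt ltK -leqNgt eqSS.
- by case/and3P=> /XA; lia.
Qed.

Lemma sum_nat_indic i j x :
  (\sum_(i <= k < j) (k == x) = (i <= x < j))%N.
Proof.
case: (boolP (i <= x < j)%N) => [x_ij|x_ij].
  rewrite (bigD1_seq x) ?mem_index_iota ?iota_uniq //= eqxx big1 // => k.
  by move/negPf->.
rewrite big_nat big1 // => k k_ij; case: eqVneq => // eq_kx.
by rewrite -eq_kx k_ij in x_ij.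
Qed.

(* A tree with m nodes has m + 1 leaves; every gap in play needs a leaf of its
   own and every node uses up a key in play. *)
Lemma gaps_le_keys T A i j X : in_play A i j X -> correct_on A T ->
  (i < j <= n.+1)%N -> (j - i <= (\sum_(i <= k < j) X k).+1)%N.
Proof.
elim: T A i j X => [|e s l IHl r IHr] A i j X play.
  case/correct_on_leaf=> _ gapsA /andP[lt_ij le_jn].
  have [gapsX _ _] := play.
  have i_lt : (i < n.+1)%N by lia.
  have j_lt : (j.-1 < n.+1)%N by lia.
  have [v gv] := gap_exists (Ordinal i_lt).
  have [w gw] := gap_exists (Ordinal j_lt).
  suff [] : Ordinal i_lt = Ordinal j_lt by lia.
  by apply: (gapsA _ _ _ _ gv gw); [rewrite (gapsX _ _ gv)|rewrite (gapsX _ _ gw)];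
    rewrite /=; lia.
case/correct_on_node=> Ae _ corr_l corr_r /andP[lt_ij le_jn].
have [_ keysX XA] := play.
have Xe : X e.+1 by rewrite -keysX.
have playl := in_play_left e s play; have playr := in_play_right e s play.
(* An improper split sends all gaps to one child, whose keys form a subset of [X], so the bound for
   that child suffices. *)
have [le_si|lt_is] := leqP s.+1 i.
  have := IHr _ _ _ _ playr corr_r; rewrite (maxn_idPr le_si) lt_ij le_jn.
  move=> /(_ isT) /leq_trans; apply; rewrite ltnS; apply: leq_sum => k _ /=.
  by case: (X k); lia.
have [le_js|lt_sj] := leqP j s.+1.
  have := IHl _ _ _ _ playl corr_l; rewrite (minn_idPr le_js) lt_ij le_jn.
  move=> /(_ isT) /leq_trans; apply; rewrite ltnS; apply: leq_sum => k _ /=.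
  by case: (X k); lia.
have := IHl _ _ _ _ playl corr_l; have := IHr _ _ _ _ playr corr_r.
rewrite (minn_idPl (ltnW lt_sj)) (maxn_idPl (ltnW lt_is)) lt_is lt_sj le_jn.
move=> /(_ isT) cnt_r /(_ ltac:(lia)) cnt_l.
(* The equality key is on neither side; counting it pays for the extra leaf when the two bounds are
   added. *)
have : (\sum_(i <= k < s.+1) [&& X k, k != e.+1 & k < s.+1] +
        \sum_(s.+1 <= k < j) [&& X k, k != e.+1 & s.+1 <= k] +
        \sum_(i <= k < j) (k == e.+1) <= \sum_(i <= k < j) X k)%N.
  rewrite !(big_cat_nat (ltnW lt_is) (ltnW lt_sj)) /= addnACA -!big_split /=.
  by apply: leq_add; apply: leq_sum => k _; case: eqVneq => [->|_];
    rewrite ?Xe; case: (X k); lia.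
rewrite sum_nat_indic XA //=; move: cnt_l cnt_r; cbn; lia.
Qed.

Context (b : nat -> R).
Hypothesis b_beta : forall k : 'I_n, b k.+1 = beta k.

Definition keys_but (i j r : nat) : pred nat :=
  [pred k | (i <= k < j)%N && (k != r)].

(* Index k > 0 stands for the key K (k - 1), which is the left end of gap k. *)
Fixpoint spans (i j r : nat) (T : split_tree n) : Prop :=
  match T with
  | Leaf => j = i.+1
  | Node e s l r' =>
      [/\ (i < s.+1 < j)%N, keys_but i j r e.+1,
          forall k, keys_but i j r k -> b k <= b e.+1
        & if (r <= s)%N
          then [/\ (s <= e)%N, spans i s.+1 r l & spans s.+1 j e.+1 r']
          else [/\ (e < s)%N, spans i s.+1 e.+1 l & spans s.+1 j r r']]
  end.

Lemma in_play_eq A i j X Y : X =1 Y -> in_play A i j X -> in_play A i j Y.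
Proof.
by move=> eqXY [gapsA keysA XA]; split=> // k; rewrite -eqXY; [apply: keysA|apply: XA].
Qed.

(** Index 0 is no real key, so it must be the removed one when [i = 0]. By [gaps_le_keys] neither
    child can lack two keys of its interval; this makes the split proper and separates [r] from the
    equality key. *)
Lemma correct_spans T A i j r : in_play A i j (keys_but i j r) ->
  (i <= r < j)%N -> (j <= n.+1)%N -> (i = 0 -> r = 0)%N ->
  correct_on A T -> spans i j r T.
Proof.
elim: T A i j r => [|e s l IHl r IHr] A i j x play x_ij le_jn x0.
  case/correct_on_leaf=> noA gapsA; have [gapsX keysX _] := play.
  have i_lt : (i < n.+1)%N by lia.
  have j_lt : (j.-1 < n.+1)%N by lia.
  have [v gv] := gap_exists (Ordinal i_lt).
  have [w gw] := gap_exists (Ordinal j_lt).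
  suff [] : Ordinal i_lt = Ordinal j_lt by rewrite /=; lia.
  by apply: (gapsA _ _ _ _ gv gw); [rewrite (gapsX _ _ gv)|rewrite (gapsX _ _ gw)];
    rewrite /=; lia.
case/correct_on_node=> Ae le_e corr_l corr_r.
have [_ keysX _] := play.
have Xe : keys_but i j x e.+1 by rewrite -keysX.
pose XL : pred nat := [pred k | [&& keys_but i j x k, k != e.+1 & k < s.+1]]%N.
pose XR : pred nat := [pred k | [&& keys_but i j x k, k != e.+1 & s.+1 <= k]]%N.
have playl : in_play _ i (minn s.+1 j) XL := in_play_left e s play.
have playr : in_play _ (maxn s.+1 i) j XR := in_play_right e s play.
have XLP k : XL k -> (k != x) && (k != e.+1) by case/and3P=> /andP[_ ->] ->.
have XRP k : XR k -> (k != x) && (k != e.+1) by case/and3P=> /andP[_ ->] ->.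
have max_e k : keys_but i j x k -> b k <= b e.+1.
  (* Index 0 would need [i = 0], but then it is the removed key. *)
  case: k => [|k] kX; first by case/andP: kX; lia.
  have k_lt : (k < n)%N by case/andP: kX; lia.
  by have := le_e (Ordinal k_lt); rewrite keysX -!b_beta; apply.
have /andP[e_ij e_x] := Xe.
(* A set avoiding both [x] and [e.+1] misses one index of [[p, q)] for each of the two that lies
   there. *)
have cnt p q (X : pred nat) :
    (forall k, X k -> (k != x) && (k != e.+1)) ->
    (\sum_(p <= k < q) X k + (p <= x < q) + (p <= e.+1 < q) <= q - p)%N.
  move=> notX; rewrite -!sum_nat_indic -!big_split /=.
  rewrite -[leqRHS]muln1 -sum_nat_const_nat; apply: leq_sum => k _.
  case Xk: (X k).
    by have /andP[/negPf-> /negPf->] := notX k Xk.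
  by have [->|_] := eqVneq k x; [rewrite eq_sym (negPf e_x)|case: (_ == _)].
(* If all gaps went to one side, that child would lack both [x] and [e.+1], one key too many. *)
have [le_si|lt_is] := leqP s.+1 i.
  have := gaps_le_keys playr corr_r; rewrite (maxn_idPr le_si) => le_k.
  by exfalso; have := cnt i j XR XRP; lia.
have [le_js|lt_sj] := leqP j s.+1.
  have := gaps_le_keys playl corr_l; rewrite (minn_idPr le_js) => le_k.
  by exfalso; have := cnt i j XL XLP; lia.
rewrite (minn_idPl (ltnW lt_sj)) in playl.
rewrite (maxn_idPl (ltnW lt_is)) in playr.
have sep_l : ~~ ((x < s.+1) && (e < s))%N.
  have := gaps_le_keys playl corr_l.
  by have := cnt i s.+1 XL XLP; lia.
have sep_r : ~~ ((s.+1 <= x) && (s <= e))%N.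
  have := gaps_le_keys playr corr_r.
  by have := cnt s.+1 j XR XRP; lia.
split=> //; first by rewrite lt_is.
case: (leqP x s) => [le_xs|lt_sx]; split; try lia.
- apply: IHl corr_l; try lia; apply: in_play_eq playl => k; rewrite ?/XL /keys_but /=; lia.
- apply: IHr corr_r; try lia; apply: in_play_eq playr => k; rewrite ?/XR /keys_but /=; lia.
- apply: IHl corr_l; try lia; apply: in_play_eq playl => k; rewrite ?/XL /keys_but /=; lia.
- apply: IHr corr_r; try lia; apply: in_play_eq playr => k; rewrite ?/XR /keys_but /=; lia.
Qed.

(** In a leaf the only index of the interval is the removed one, so no key is left; at a node,
    separating [r] from the equality key leaves each side with a single removed key. *)
Lemma spans_correct T A i j r : in_play A i j (keys_but i j r) ->
  (i <= r < j)%N -> (j <= n.+1)%N -> spans i j r T -> correct_on A T.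
Proof.
elim: T A i j r => [|e s l IHl r IHr] A i j x play x_ij le_jn.
  have [gapsX keysX _] := play.
  move=> /= def_j; apply/correct_on_leaf; split=> [k|g h v w gv gw].
    by rewrite keysX /keys_but /=; lia.
  by rewrite (gapsX _ _ gv) (gapsX _ _ gw) => *; apply: val_inj => /=; lia.
have playl := in_play_left e s play; have playr := in_play_right e s play.
have [_ keysX _] := play.
case=> s_ij Xe max_e sep; have /andP[e_ij e_x] := Xe.
rewrite (minn_idPl _) in playl; last by lia.
rewrite (maxn_idPl _) in playr; last by lia.
apply/correct_on_node; split.
- by rewrite keysX.
- by move=> k; rewrite keysX -!b_beta; apply: max_e.
- move: sep; case: (leqP x s) => [le_xs|lt_sx] [sep spl spr]; apply: IHl spl; try lia;
    by apply: in_play_eq playl => k; rewrite /keys_but /=; lia.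
- move: sep; case: (leqP x s) => [le_xs|lt_sx] [sep spl spr]; apply: IHr spr; try lia;
    by apply: in_play_eq playr => k; rewrite /keys_but /=; lia.
Qed.

Lemma in_play_predT : in_play predT 0 n.+1 (keys_but 0 n.+1 0).
Proof.
split=> [g v _|k|k] //=; first by rewrite ltn_ord.
  by rewrite /keys_but /= ltnS ltn_ord.
by case/andP.
Qed.

Lemma binary_split_tree_spans T :
  binary_split_tree K beta T <-> spans 0 n.+1 0 T.
Proof.
rewrite -correct_on_predT; split.
  exact: (correct_spans in_play_predT).
exact: (spans_correct in_play_predT).
Qed.

End Trees.

(** * The recurrence *)

Section Recurrence.
Local Open Scope ring_scope.
Context {R : realType} (a b : nat -> R).

(* The leftmost position of the maximum of b on [i, j). *)
Fixpoint top (i j : nat) : nat :=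
  if j is j'.+1 then
    if (j' <= i)%N then i else if b j' <= b (top i j') then top i j' else j'
  else i.

Lemma top_rec i j : (i < j)%N ->
  top i j.+1 = if b j <= b (top i j) then top i j else j.
Proof. by move=> lt_ij; rewrite /= leqNgt lt_ij. Qed.

Lemma top1 i : top i i.+1 = i.
Proof. by rewrite /= leqnn. Qed.

Lemma topP i j : (i < j)%N ->
  [/\ (i <= top i j < j)%N, forall k, (i <= k < j)%N -> b k <= b (top i j)
    & forall k, (i <= k < top i j)%N -> b k < b (top i j)].
Proof.
elim: j => // j IH; rewrite ltnS leq_eqVlt => /predU1P[<-|lt_ij].
  rewrite top1; split=> [|k|k]; try lia.
  by move=> k_i; rewrite (_ : k = i) //; lia.
have [t_ij max_t first_t] := IH lt_ij.
rewrite top_rec //; case: leP => [le_jt|lt_tj].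
  split=> [|k k_ij|//]; first by lia.
  by case: (eqVneq k j) => [->//|ne_kj]; apply: max_t; lia.
split=> [|k k_ij|k k_ij]; first by lia.
  case: (eqVneq k j) => [->//|ne_kj].
  by apply/ltW/(le_lt_trans _ lt_tj)/max_t; lia.
by apply: le_lt_trans lt_tj; apply: max_t.
Qed.

Lemma top_unique i j t : (i <= t < j)%N ->
  (forall k, (i <= k < j)%N -> b k <= b t) ->
  (forall k, (i <= k < t)%N -> b k < b t) -> top i j = t.
Proof.
move=> t_ij max_t first_t.
have [//|t'_ij max_t' first_t'] := @topP i j; first by lia.
case: (ltngtP (top i j) t) => // [lt|gt].
  have := first_t (top i j); rewrite lt => /(_ ltac:(lia)).
  by rewrite ltNge max_t'.
have := first_t' t; rewrite gt => /(_ ltac:(lia)).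
by rewrite ltNge max_t //; lia.
Qed.

(** Choosing the leftmost maximum makes [top] hereditary: a subinterval containing it has the same
    top. *)
Lemma top_left i s j : (i < s < j)%N -> (top i j < s)%N -> top i s = top i j.
Proof.
move=> s_ij lt_ts; have [|t_ij max_t first_t] := @topP i j; first by lia.
by apply: top_unique => // [|k k_is]; [lia|apply: max_t; lia].
Qed.

Lemma top_right i s j : (i < s < j)%N -> (s <= top i j)%N -> top s j = top i j.
Proof.
move=> s_ij le_st; have [|t_ij max_t first_t] := @topP i j; first by lia.
by apply: top_unique => [|k k_is|k k_is]; [lia|apply: max_t; lia|apply: first_t; lia].
Qed.

(* One of the two halves has the same top as [i, j); this is the other top. *)
Definition other (i s j : nat) : nat := (top i s + top s j - top i j)%N.

Lemma otherP i s j : (i < s < j)%N ->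
  if (top i j < s)%N then top i s = top i j /\ other i s j = top s j
  else top s j = top i j /\ other i s j = top i s.
Proof.
move=> s_ij; rewrite /other; case: ltnP => [lt|le].
  by rewrite (top_left s_ij lt); split; lia.
by rewrite (top_right s_ij le); split; lia.
Qed.

Definition mass (i j : nat) : R := \sum_(i <= k < j) (a k + b k).

(** The root is reached by the weight of [[i, j)] less the removed key. Any removed key of maximum
    weight weighs as much as [top i j], so the formula need not know which one it is. *)
Fixpoint span_cost n (i j : nat) (T : split_tree n) : R :=
  if T is Node _ s l r then
    mass i j - b (top i j) + (span_cost i s.+1 l + span_cost s.+1 j r)
  else 0.

Context (F : nat -> nat -> R).

(* A split s is feasible iff the two tops of the halves can be the key removed
   before and the key removed at this node, i.e. iff b (other i s j) is the
   second largest weight.  That value is the maximum over all splits, so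
   feasibility need not be tested separately. *)
Definition best_split (i j s : nat) : Prop :=
  (i < s < j)%N /\ forall s', (i < s' < j)%N ->
    b (other i s' j) <= b (other i s j) /\
    (b (other i s j) <= b (other i s' j) -> F i s + F s j <= F i s' + F s' j).

(** The split at [maxn k (top i j)] separates [k] from the top, so [k] lies in the half whose
    maximum is the other top; the best split does at least as well. *)
Lemma other_second i j s k : best_split i j s -> (i <= k < j)%N ->
  k != top i j -> b k <= b (other i s j).
Proof.
move=> [s_ij best] k_ij k_t.
have [|t_ij max_t first_t] := @topP i j; first by lia.
have s'_ij : (i < maxn k (top i j) < j)%N by lia.
have [le_s' _] := best _ s'_ij; apply: le_trans le_s'.
have := otherP s'_ij; have [|t1 max1 _] := @topP i (maxn k (top i j)); first by lia.
have [|t2 max2 _] := @topP (maxn k (top i j)) j; first by lia.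
case: ltnP => [lt|le] [_ ->]; [apply: max2|apply: max1]; lia.
Qed.

(** Ties are the difficulty: [x] and [e] need not be the indices chosen by [top]. The half without
    [top i j] contains [x] or [e], so its maximum is at least [b e], while the other top of any
    split weighs at most [b e]. *)
Lemma other_top i j s e x : (i < s < j)%N -> (i <= e < j)%N -> (i <= x < j)%N ->
  e != x -> (forall k, (i <= k < j)%N -> k != x -> b k <= b e) ->
  (forall k, (i <= k < j)%N -> b k <= b x) -> (x < s)%N = (s <= e)%N ->
  forall s', (i < s' < j)%N -> b (other i s' j) <= b (other i s j).
Proof.
move=> s_ij e_ij x_ij e_x max_e max_x sep s' s'_ij.
have [|t_ij max_t first_t] := @topP i j; first by lia.
have le_e : b e <= b (other i s j).
  have := otherP s_ij; have [|t1 max1 _] := @topP i s; first by lia.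
  have [|t2 max2 _] := @topP s j; first by lia.
  case: ltnP => [lt|le] [_ ->].
    case: (ltnP e s) => [lt_es|le_se]; last by apply: max2; lia.
    apply: le_trans (max_x _ e_ij) _; apply: max2; lia.
  case: (ltnP e s) => [lt_es|le_se]; first by apply: max1; lia.
  by apply: le_trans (max_x _ e_ij) _; apply: max1; lia.
apply: le_trans le_e.
have [w_ij w_t] : (i <= other i s' j < j)%N /\ other i s' j != top i j.
  have := otherP s'_ij; have [|t1 _ _] := @topP i s'; first by lia.
  have [|t2 _ _] := @topP s' j; first by lia.
  by case: ltnP => [lt|le] [? ->]; lia.
(* If the other top is [x], then [top i j] is not, and it weighs at least [b x] and at most
   [b e]. *)
case: (eqVneq (other i s' j) x) => [w_x|]; last exact: max_e.
rewrite w_x; apply: le_trans (max_t _ x_ij) _; apply: max_e => //.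
by rewrite -w_x eq_sym.
Qed.

Context (N : nat).
Hypothesis F1 : forall i, (i < N)%N -> F i i.+1 = 0.
Hypothesis Frec : forall i j, (i.+1 < j <= N)%N -> exists2 s, best_split i j s &
  F i j = mass i j - b (top i j) + (F i s + F s j).

(** The root split of [T] is feasible by [other_top], so the minimising split is no more expensive.
    Each child has its own removed key, [x] on one side and [e.+1] on the other, of maximum weight
    there. *)
Lemma span_cost_ge n (T : split_tree n) i j x : spans b i j x T ->
  (j <= N)%N -> (i <= x < j)%N -> (forall k, (i <= k < j)%N -> b k <= b x) ->
  F i j <= span_cost i j T.
Proof.
elim: T i j x => [|e s l IHl r IHr] i j x /=; first by move=> -> *; rewrite F1.
move=> [s_ij /andP[e_ij e_x] max_e sep] le_jN x_ij max_x.
have [s0 [s0_ij best] ->] := Frec (i := i) (j := j) ltac:(lia).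
rewrite lerD2l.
have max_e' k : (i <= k < j)%N -> k != x -> b k <= b e.+1.
  by move=> k_ij k_x; apply: max_e; rewrite /keys_but /= k_ij.
have sepx : (x < s.+1)%N = (s.+1 <= e.+1)%N.
  by move: sep; case: (leqP x s) => [le_xs|lt_sx] [sep _ _]; lia.
have [_] := best _ s_ij; move=> /(_ (other_top s_ij e_ij x_ij e_x max_e' max_x sepx s0_ij)).
move/le_trans; apply; apply: lerD.
  move: sep; case: (leqP x s) => [le_xs|lt_sx] [sep spl _]; apply: IHl spl _ _ _;
   try lia; move=> k k_is; [apply: max_x|apply: max_e']; lia.
move: sep; case: (leqP x s) => [le_xs|lt_sx] [sep _ spr]; apply: IHr spr _ _ _;
   try lia; move=> k k_is; [apply: max_e'|apply: max_x]; lia.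
Qed.

End Recurrence.


(** * The filled table read as stored trees *)

Section Table.
Local Open Scope ring_scope.
Context {R : realType} (n : nat) (a b : nat -> R).

(** Row-major addressing; columns run from 0 to [n.+1], hence rows of length [n.+2]. *)
Definition addr (i j : nat) : nat := (i * n.+2 + j)%N.

(** An entry doubles as a tree vertex at the same address; the predecessors undo the shift of key
    indices. *)
Definition table_entry (m : nat -> nat -> nat) (F : nat -> nat -> R) (i j : nat) :
    Prop :=
  if j == i.+1 then m 1%N (addr i j) = 0%N /\ F i j = 0
  else exists s, [/\ best_split b F i j s,
    F i j = mass a b i j - b (top b i j) + (F i s + F s j),
    [/\ m 1%N (addr i j) = 1%N, m 2%N (addr i j) = (other b i s j).-1
       & m 3%N (addr i j) = s.-1]
    & m 4%N (addr i j) = addr i s /\ m 5%N (addr i j) = addr s j].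

Hypothesis b0_max : forall k, (k <= n)%N -> b k <= b 0%N.

Lemma top0 j : (0 < j <= n.+1)%N -> top b 0 j = 0%N.
Proof.
move=> j_n; apply: top_unique => [|k k_j|k]; try lia.
by apply: b0_max; lia.
Qed.

Context (m : nat -> nat -> nat) (F : nat -> nat -> R).
Hypothesis tableP : forall i j, (i < j <= n.+1)%N -> table_entry m F i j.

(* At i = 0 the removed key is the virtual one, so the equality key is a real key. *)
Lemma table_tree i j : (i < j <= n.+1)%N -> exists T : split_tree n,
  [/\ tree_at m (addr i j) T, spans b i j (top b i j) T
    & span_cost a b i j T = F i j].
Proof.
have [d] := ubnP (j - i); elim: d i j => // d IH i j lt_d ij_n.
have := tableP ij_n; rewrite /table_entry; case: eqVneq => [eq_j|ne_j].
  by case=> m1 F0; exists Leaf; split=> //=.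
case=> s [best_s F_ij [m1 m2 m3] [m4 m5]]; have [s_ij _] := best_s.
have [l [mem_l span_l cost_l]] := IH i s ltac:(lia) ltac:(lia).
have [r [mem_r span_r cost_r]] := IH s j ltac:(lia) ltac:(lia).
have [|t_ij max_t _] := @topP _ b i j; first by lia.
have [|tl_is _ _] := @topP _ b i s; first by lia.
have [|tr_sj _ _] := @topP _ b s j; first by lia.
have o_gt0 : (0 < other b i s j < j)%N /\ (i <= other b i s j)%N
    /\ other b i s j != top b i j.
  have := otherP b s_ij; case: ltnP => [lt|le] [eq_t ->]; split; try lia.
  by case: (posnP i) => [i0|]; [move: eq_t le; rewrite i0 !top0; lia|lia].
case: o_gt0 => o_gt0 [le_io o_t].
have e_n : ((other b i s j).-1 < n)%N by lia.
have s_n : (s.-1 < n)%N by lia.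
have e_pred : (other b i s j).-1.+1 = other b i s j by lia.
have s_pred : s.-1.+1 = s by lia.
exists (Node (Ordinal e_n) (Ordinal s_n) l r); split=> /=.
- by rewrite m1 m2 m3 m4 m5.
- rewrite e_pred s_pred; split=> //.
  + by rewrite /keys_but /= o_t; lia.
  + by move=> k /andP[k_ij k_t]; apply: other_second best_s _ _.
  + have := otherP b s_ij; case: ltnP => [lt|le] [eq_t eq_o].
      by rewrite (_ : (top b i j <= s.-1)%N); [rewrite eq_o -eq_t; split=> //|]; lia.
    rewrite (_ : (top b i j <= s.-1)%N = false); last by lia.
    by rewrite eq_o -eq_t; split=> //; lia.
- by rewrite s_pred cost_l cost_r F_ij.
Qed.

End Table.

(** * The cost in terms of the weights of keys and gaps *)

Section Cost.
Local Open Scope ring_scope.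
Context {R : realType} {n : nat} (K : 'I_n -> R).
Context (alpha : 'I_n.+1 -> R) (beta : 'I_n -> R).
Hypothesis K_mono : forall i j : 'I_n, (i < j)%N -> K i < K j.

Definition gap_point (g : 'I_n.+1) : R := sval (cid (gap_exists K_mono g)).

Lemma gap_pointP g : gap K g (gap_point g).
Proof. exact: svalP. Qed.

Definition weight (A : pred R) : R :=
  \sum_(k | A (K k)) beta k + \sum_(g | A (gap_point g)) alpha g.

Definition weighted_visits (A : pred R) (T : split_tree n) : R :=
  \sum_(k | A (K k)) beta k * (visits K T (K k))%:R +
  \sum_(g | A (gap_point g)) alpha g * (visits K T (gap_point g))%:R.

(** A query pays one for the root and moves on to at most one side. An arbitrary finite family
    covers keys and gaps at once. *)
Lemma sum_visits_node (I : finType) (x w : I -> R) (A : pred R) e s l r :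
  \sum_(i | A (x i)) w i * (visits K (Node e s l r) (x i))%:R =
  \sum_(i | A (x i)) w i +
  (\sum_(i | go_left K A e s (x i)) w i * (visits K l (x i))%:R +
   \sum_(i | go_right K A e s (x i)) w i * (visits K r (x i))%:R).
Proof.
rewrite [LHS]big_mkcond [X in _ = X + _]big_mkcond [X in _ = _ + (X + _)]big_mkcond.
rewrite [X in _ = _ + (_ + X)]big_mkcond -!big_split; apply: eq_bigr => i _ /=.
rewrite /go_left /go_right /= leNgt; case: (A (x i)) => /=; last by rewrite !addr0.
case: eqVneq => [_|ne] /=; first by rewrite mulr1 !addr0.
by case: ltP => _ /=; rewrite -natr1 mulrDr mulr1 ?addr0 ?add0r addrC.
Qed.

Lemma weighted_visits_node A e s l r :
  weighted_visits A (Node e s l r) = weight A +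
    (weighted_visits (go_left K A e s) l + weighted_visits (go_right K A e s) r).
Proof. by rewrite /weighted_visits !sum_visits_node /weight; lra. Qed.

Context (a b : nat -> R).
Hypothesis a_alpha : forall g : 'I_n.+1, a g = alpha g.
Hypothesis b_beta : forall k : 'I_n, b k.+1 = beta k.

Lemma sum_ord_interval i j N (f : nat -> R) : (j <= N)%N ->
  \sum_(k < N | (i <= k < j)%N) f k = \sum_(i <= k < j) f k.
Proof.
move=> le_jN; rewrite (big_nat_widen _ _ _ _ _ le_jN) (big_nat_widenl _ _ _ _ _ (leq0n i)).
by rewrite big_mkord; apply: eq_bigl => k; rewrite andbC.
Qed.

(** For [i = 0] the mass includes the virtual weight, and [x = 0] makes the subtraction cancel
    it. *)
Lemma weight_in_play A i j x : in_play K A i j (keys_but i j x) ->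
  (i <= x < j)%N -> (j <= n.+1)%N -> (i = 0 -> x = 0)%N ->
  weight A = mass a b i j - b x.
Proof.
move=> [gapsA keysA _] x_ij le_jn x0.
rewrite /weight /mass big_split /= [LHS]addrC -addrA; congr (_ + _).
  rewrite -(sum_ord_interval _ _ le_jn); apply: eq_big => g //.
  by rewrite (gapsA _ _ (gap_pointP g)).
transitivity (\sum_(k < n.+1 | keys_but i j x k) b k).
  rewrite [RHS]big_mkcond big_ord_recl /= [X in X + _](_ : _ = 0) ?add0r.
    rewrite -big_mkcond; apply: eq_big => k //; rewrite keysA //.
  by rewrite /keys_but /=; case: ifP => //; lia.
rewrite [X in _ = X - _](bigD1_seq x) ?mem_index_iota ?iota_uniq //=.
rewrite [X in _ = X - _]addrC addrK (big_nat_widen _ _ _ _ _ le_jn).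
rewrite (big_nat_widenl _ _ _ _ _ (leq0n i)) big_mkord; apply: eq_bigl => k.
by rewrite /keys_but /=; lia.
Qed.

Lemma weighted_visits_leaf A : weighted_visits A Leaf = 0.
Proof. by rewrite /weighted_visits !big1 ?addr0 // => i _; rewrite mulr0. Qed.

Lemma weighted_visits_spans T A i j x : in_play K A i j (keys_but i j x) ->
  (i <= x < j)%N -> (j <= n.+1)%N -> (i = 0 -> x = 0)%N ->
  (forall k, (i <= k < j)%N -> b k <= b x) -> spans b i j x T ->
  weighted_visits A T = span_cost a b i j T.
Proof.
elim: T A i j x => [|e s l IHl r IHr] A i j x play x_ij le_jn x0 max_x.
  by rewrite weighted_visits_leaf.
case=> s_ij Xe max_e sep; have /andP[e_ij e_x] := Xe.
have playl := in_play_left K_mono e s play.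
have playr := in_play_right K_mono e s play.
rewrite (minn_idPl _) in playl; last by lia.
rewrite (maxn_idPl _) in playr; last by lia.
rewrite weighted_visits_node (weight_in_play play) //=.
have [|t_ij max_t _] := @topP _ b i j; first by lia.
(* Under ties [x] may differ from [top b i j], but both attain the maximum weight. *)
have -> : b x = b (top b i j) by apply/le_anti; rewrite max_t //= max_x.
have max_e' k : (i <= k < j)%N -> k != x -> b k <= b e.+1.
  by move=> k_ij k_x; apply: max_e; rewrite /keys_but /= k_ij.
move: sep; case: (leqP x s) => [le_xs|lt_sx] [sep spl spr]; congr (_ + (_ + _)).
- apply: IHl _ spl; try lia; last by move=> k k_is; apply: max_x; lia.
  by apply: in_play_eq playl => k; rewrite /keys_but /=; lia.
- apply: IHr _ spr; try lia; last by move=> k k_sj; apply: max_e'; lia.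
  by apply: in_play_eq playr => k; rewrite /keys_but /=; lia.
- apply: IHl _ spl; try lia; last by move=> k k_is; apply: max_e'; lia.
  by apply: in_play_eq playl => k; rewrite /keys_but /=; lia.
- apply: IHr _ spr; try lia; last by move=> k k_sj; apply: max_x; lia.
  by apply: in_play_eq playr => k; rewrite /keys_but /=; lia.
Qed.

Lemma visits_gap T g v w : gap K g v -> gap K g w -> visits K T v = visits K T w.
Proof.
move=> gv gw; elim: T => //= e s l -> r ->.
rewrite (negPf (gap_neqK K_mono e gv)) (negPf (gap_neqK K_mono e gw)).
by rewrite (gap_ltK K_mono s gv) (gap_ltK K_mono s gw).
Qed.

Lemma gap_inj g h v : gap K g v -> gap K h v -> g = h.
Proof.
wlog: g h / (g <= h)%N => [th gv hv|].
  by case: (leqP g h) => [|/ltnW] le; [|symmetry]; apply: th.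
rewrite leq_eqVlt => /predU1P[/val_inj//|lt_gh] gv hv.
have g_n : (g < n)%N by have := ltn_ord h; lia.
have := gap_ltK K_mono (Ordinal g_n) gv.
by rewrite (gap_ltK K_mono (Ordinal g_n) hv) /= leqnn leqNgt lt_gh.
Qed.

Lemma key_or_gap v : (exists k, v = K k) \/ (exists g, gap K g v).
Proof.
have [/existsP[k /eqP]|/existsPn notK] := boolP [exists k, v == K k].
  by left; exists k.
right; have [all_lt|] := boolP [forall k, K k < v].
  exists ord_max; split=> [j _|j /= jn]; first exact/(forallP all_lt).
  by have := ltn_ord j; rewrite jn ltnn.
case/forallPn=> k0; rewrite -leNgt => le_vk0.
pose ok := [pred j : 'I_n | v <= K j].
(* The least key that is at least [v] ends the gap containing [v]. *)
case: (@arg_minnP _ k0 ok (fun j => j : nat) le_vk0) => k le_vk min_k.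
exists (widen_ord (leqnSn n) k); split=> j /= jk.
  by rewrite ltNge; apply/negP => /min_k; lia.
by rewrite (val_inj jk) lt_neqAle notK.
Qed.

(** * The expectation as a finite sum *)

Section Expectation.
Context (d : measure_display) (Omega : measurableType d).
Context (P : probability Omega R) (V : {RV P >-> R}).
Hypothesis P_key : forall k, P (V @^-1` [set K k])%classic = (beta k)%:E.
Hypothesis P_gap : forall g, P (V @^-1` gap K g)%classic = (alpha g)%:E.

Definition atom (i : 'I_n + 'I_n.+1) : set R :=
  match i with inl k => [set K k]%classic | inr g => gap K g end.

Definition atom_point (i : 'I_n + 'I_n.+1) : R :=
  match i with inl k => K k | inr g => gap_point g end.

Definition atom_weight (i : 'I_n + 'I_n.+1) : R :=
  match i with inl k => beta k | inr g => alpha g end.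

Lemma atom_exists v : exists i, atom i v.
Proof.
by have [[k ->]|[g gv]] := key_or_gap v; [exists (inl k)|exists (inr g)].
Qed.

Lemma atom_inj i j v : atom i v -> atom j v -> i = j.
Proof.
case: i => i; case: j => j /=.
- by move=> -> /eqP; rewrite eqK // => /eqP ->.
- by move=> -> /(gap_neqK K_mono i); rewrite eqxx.
- by move=> gv eq_v; move: (gap_neqK K_mono j gv); rewrite eq_v eqxx.
- by move=> gv hv; rewrite (gap_inj gv hv).
Qed.

Lemma visits_atom T i v : atom i v -> visits K T v = visits K T (atom_point i).
Proof.
by case: i => [k ->//|g] gv; apply: visits_gap gv (gap_pointP g).
Qed.

Lemma measurable_atom i : measurable (atom i).
Proof.
case: i => [k|g]; first exact: measurable_set1.
(* A gap is an intersection of open rays; at either end of the line an empty intersection imposes no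
   bound. *)
rewrite (_ : atom (inr g) =
  (\bigcap_(j in [set j : 'I_n | j.+1 = g :> nat]) `]K j, +oo[ `&`
   \bigcap_(j in [set j : 'I_n | j = g :> nat]) `]-oo, K j[)%classic).
  by apply: measurableI; apply: fin_bigcap_measurable => [|j _];
    [exact: finite_finset|exact: measurable_itv|exact: finite_finset|
     exact: measurable_itv].
by apply/seteqP; split=> v /= [lo hi]; split=> j jg;
  [have := lo j jg|have := hi j jg|have := lo j jg|have := hi j jg];
  rewrite /= in_itv /= ?andbT.
Qed.

(** Keys and gaps partition the line, and [visits] is constant on each part, so the integrand is a
    nonnegative simple function and its integral a finite sum. *)
Lemma cost_weighted_visits T : cost K V T = (weighted_visits predT T)%:E.
Proof.
rewrite /cost unlock.
pose c i := (visits K T (atom_point i))%:R : R.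
have mV i : measurable (V @^-1` atom i)%classic.
  by rewrite -[X in measurable X]setTI; apply: measurable_funPT => //; apply: measurable_atom.
transitivity (\int[P]_w (\sum_i (c i * \1_(V @^-1` atom i)%classic w)%:E))%E.
  apply: eq_integral => w _.
  have [i iV] := atom_exists (V w).
  rewrite (bigD1 i) //= big1 ?adde0; last first.
    move=> j ne_ji; rewrite indicE memNset ?mulr0 //= => jV.
    by rewrite (atom_inj iV jV) eqxx in ne_ji.
  by rewrite indicE mem_set // mulr1 /c -(visits_atom T iV).
rewrite ge0_integral_sum //; last 2 first.
- move=> i; apply/measurable_EFinP; apply: measurable_funM => //.
- by move=> i w _; rewrite lee_fin mulr_ge0.
transitivity (\sum_i (c i * atom_weight i)%:E)%E.
  apply: eq_bigr => i _.
  rewrite (@integralZl_indic _ _ _ _ _ _ (fun=> (V @^-1` atom i)%classic)) //.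
    rewrite integral_indic // setIT EFinM; congr (_ * _)%E.
    by case: i => [k|g] /=; [apply: P_key|apply: P_gap].
  by rewrite ltNge ler0n.
rewrite sumEFin big_sumType /weighted_visits; congr (_ + _)%:E;
  by apply: eq_bigr => i _; rewrite mulrC.
Qed.

End Expectation.

End Cost.

(** * The program *)

Section Runs.
Context {R : realType} (W : nat).

(** Total correctness with an upper time bound, so that branches of different length can share one
    bound. *)
Definition runs (c : cmd) (st : state R) (t : nat) (Q : state R -> Prop) : Prop :=
  exists t' st', [/\ exec W c st t' st', t' <= t & Q st'].

Lemma runs_mono c st t t' (Q Q' : state R -> Prop) : runs c st t Q -> t <= t' ->
  (forall st', Q st' -> Q' st') -> runs c st t' Q'.
Proof.
move=> [u [st' [ex le_ut Qst]]] le_tt' QQ'; exists u, st'.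
by split; [|apply: leq_trans le_tt'|apply: QQ'].
Qed.

Lemma runs_seq c1 c2 st t1 t2 Q :
  runs c1 st t1 (fun st1 => runs c2 st1 t2 Q) -> runs (Seq c1 c2) st (t1 + t2) Q.
Proof.
move=> [u1 [st1 [ex1 le1 [u2 [st2 [ex2 le2 Q2]]]]]].
exists (u1 + u2), st2; split=> //; last exact: leq_add.
exact: ExecSeq ex1 ex2.
Qed.

(** [I] is indexed by the exact number of iterations left. The final test is charged a full
    iteration, hence [m.+1]. *)
Lemma runs_while (I : nat -> state R -> Prop) b c t :
  (forall m st, I m.+1 st -> beval st b /\ runs c st t (I m)) ->
  (forall st, I 0 st -> ~~ beval st b) ->
  forall m st, I m st -> runs (While b c) st (m.+1 * (btime b + t).+1) (I 0).
Proof.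
move=> step stop; elim=> [|m IH] st Ist.
  by exists (btime b).+1, st; split; [apply/ExecWhileFalse/stop|lia|].
have [bst [t1 [st1 [ex1 le1 I1]]]] := step _ _ Ist.
have [t2 [st2 [ex2 le2 I2]]] := IH _ I1.
exists (btime b + t1 + t2).+1, st2; split=> //; last by move: le2; lia.
exact: ExecWhileTrue ex1 ex2.
Qed.

(** A conditional is charged both branches. Loops get a dummy value, as [wp] is false for them. *)
Fixpoint straight_time (c : cmd) : nat :=
  match c with
  | Skip => 1
  | ISet _ i e => (itime i + itime e).+1
  | RSet _ i x => (itime i + rtime x).+1
  | Seq c1 c2 => straight_time c1 + straight_time c2
  | If b c1 c2 => (btime b + (straight_time c1 + straight_time c2)).+1
  | While _ _ => 0
  end.

Fixpoint wp (c : cmd) (Q : state R -> Prop) (st : state R) : Prop :=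
  match c with
  | Skip => Q st
  | ISet a i e => ieval st e < W /\
      Q (State (set_cell (ints st) a (ieval st i) (ieval st e)) (reals st))
  | RSet a i x =>
      Q (State (ints st) (set_cell (reals st) a (ieval st i) (reval st x)))
  | Seq c1 c2 => wp c1 (wp c2 Q) st
  | If b c1 c2 => if beval st b then wp c1 Q st else wp c2 Q st
  | While _ _ => False
  end.

Lemma wp_runs c Q st : wp c Q st -> runs c st (straight_time c) Q.
Proof.
elim: c Q st => //=.
- by move=> Q st Qst; exists 1, st; split=> //; constructor.
- move=> a i e Q st [lt_e Qst]; eexists _, _; split; [exact: ExecISet|by []|by []].
- move=> a i x Q st Qst; eexists _, _; split; [exact: ExecRSet|by []|by []].
- move=> c1 IH1 c2 IH2 Q st /IH1 run1; apply: runs_seq.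
  by apply: runs_mono run1 _ _ => // st'; apply: IH2.
- move=> b c1 IH1 c2 IH2 Q st; case: ifPn => bst.
    move=> /IH1[t [st' [ex le Qst]]]; exists (btime b + t).+1, st'.
    by split; [apply: ExecIfTrue|lia|].
  move=> /IH2[t [st' [ex le Qst]]]; exists (btime b + t).+1, st'.
  by split; [apply: ExecIfFalse|lia|].
Qed.

End Runs.

(* Scalars: i, j, s and the best split so far are cells 2 to 5 of integer array 0.
   Integer array 6 holds [top]; real arrays 3, 4 and 5 hold the weights b, [mass]
   and the costs F. *)
Definition var (x : nat) : iexp := IGet 0 (IConst x).
Definition var_n : iexp := var 0.
Definition var_i : iexp := var 2.
Definition var_j : iexp := var 3.
Definition var_s : iexp := var 4.
Definition var_best : iexp := var 5.
Definition isucc (e : iexp) : iexp := IAdd e (IConst 1).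
Definition ipred (e : iexp) : iexp := ISub e (IConst 1).

Definition iaddr (x y : iexp) : iexp := IAdd (IMul x (IAdd var_n (IConst 2))) y.
Definition itop (x y : iexp) : iexp := IGet 6 (iaddr x y).
Definition iother (s : iexp) : iexp :=
  ISub (IAdd (itop var_i s) (itop s var_j)) (itop var_i var_j).
Definition rweight (k : iexp) : rexp := RGet 3 k.
Definition rmass (x y : iexp) : rexp := RGet 4 (iaddr x y).
Definition rsplit (s : iexp) : rexp :=
  RAdd (RGet 5 (iaddr var_i s)) (RGet 5 (iaddr s var_j)).

(** Cell 0 accumulates the sum of the weights, which serves as the weight of the virtual key. *)
Definition shift_weight : cmd :=
  Seq (RSet 3 (isucc var_i) (RGet 2 var_i))
  (Seq (RSet 3 (IConst 0) (RAdd (RGet 3 (IConst 0)) (RGet 2 var_i)))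
       (ISet 0 (IConst 2) (isucc var_i))).

Definition shift_weights : cmd := While (BNot (BLeI var_n var_i)) shift_weight.

(** The machine has no real constants; zero is obtained as a cell minus itself. *)
Definition leaf_entry : cmd :=
  Seq (RSet 4 (iaddr var_i var_j) (RAdd (RGet 1 var_i) (rweight var_i)))
  (Seq (ISet 6 (iaddr var_i var_j) var_i)
  (Seq (ISet 1 (iaddr var_i var_j) (IConst 0))
       (RSet 5 (iaddr var_i var_j)
          (RSub (rweight (IConst 0)) (rweight (IConst 0)))))).

(** Lexicographic test: heavier other top first, then lower cost. Ties keep the current split. *)
Definition keep_best : bexp :=
  BAnd (BLeR (rweight (iother var_s)) (rweight (iother var_best)))
    (BNot (BAnd (BLeR (rweight (iother var_best)) (rweight (iother var_s)))
                (BNot (BLeR (rsplit var_best) (rsplit var_s))))).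

(** [mass] and [top] are extended from column [j - 1]. Split [i + 1] is the initial best, so the
    search starts at [i + 2]. *)
Definition open_entry : cmd :=
  Seq (RSet 4 (iaddr var_i var_j)
         (RAdd (rmass var_i (ipred var_j))
               (RAdd (RGet 1 (ipred var_j)) (rweight (ipred var_j)))))
  (Seq (If (BLeR (rweight (ipred var_j)) (rweight (itop var_i (ipred var_j))))
           (ISet 6 (iaddr var_i var_j) (itop var_i (ipred var_j)))
           (ISet 6 (iaddr var_i var_j) (ipred var_j)))
  (Seq (ISet 0 (IConst 5) (isucc var_i))
       (ISet 0 (IConst 4) (IAdd var_i (IConst 2))))).

Definition improve_split : cmd :=
  Seq (If keep_best Skip (ISet 0 (IConst 5) var_s))
      (ISet 0 (IConst 4) (isucc var_s)).

Definition close_entry : cmd :=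
  Seq (ISet 1 (iaddr var_i var_j) (IConst 1))
  (Seq (ISet 2 (iaddr var_i var_j) (ipred (iother var_best)))
  (Seq (ISet 3 (iaddr var_i var_j) (ipred var_best))
  (Seq (ISet 4 (iaddr var_i var_j) (iaddr var_i var_best))
  (Seq (ISet 5 (iaddr var_i var_j) (iaddr var_best var_j))
       (RSet 5 (iaddr var_i var_j)
          (RAdd (RSub (rmass var_i var_j) (rweight (itop var_i var_j)))
                (rsplit var_best))))))).

Definition entry_start : cmd := Seq (ISet 0 (IConst 3) (isucc var_j)) open_entry.

Definition row_start : cmd :=
  Seq (ISet 0 (IConst 2) (ipred var_i))
      (Seq (ISet 0 (IConst 3) (isucc var_i)) leaf_entry).

Definition fill_entry : cmd :=
  Seq entry_start
  (Seq (While (BNot (BLeI var_j var_s)) improve_split) close_entry).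

Definition fill_row : cmd :=
  Seq row_start (While (BLeI var_j var_n) fill_entry).

(** Rows go down from [n] and columns go up, so the two halves of an interval are filled before it.
    [row_start] decrements [i], hence the start at [n + 1]. The root address [addr n 0 n.+1] is just
    [n + 1]. *)
Definition split_tree_program : cmd :=
  Seq shift_weights
  (Seq (ISet 0 (IConst 2) (isucc var_i))
  (Seq (While (BLeI (IConst 1) var_i) fill_row)
       (ISet 0 (IConst 1) (isucc var_n)))).

(** * Correctness and running time of the program *)

Section Program.
Local Open Scope ring_scope.
Context {R : realType} (W n : nat) (a b : nat -> R).
Hypothesis W_large : (n.+1 * n.+2 + 2 <= W)%N.

Definition weights_loaded (st : state R) : Prop :=
  [/\ ints st 0 0 = n, forall k, (k <= n)%N -> reals st 1 k = a k
    & forall k, (k <= n)%N -> reals st 3 k = b k].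

Definition costs (st : state R) (i j : nat) : R := reals st 5 (addr n i j).

Definition filled_entry (st : state R) (i j : nat) : Prop :=
  [/\ ints st 6 (addr n i j) = top b i j, reals st 4 (addr n i j) = mass a b i j
    & table_entry n a b (ints st) (costs st) i j].

Definition filled (st : state R) (i0 j0 : nat) : Prop :=
  forall i j, (i < j <= n.+1)%N -> (i0 < i)%N || (i == i0) && (j <= j0)%N ->
    filled_entry st i j.

Lemma addr_inj i j i' j' : (j <= n.+1)%N -> (j' <= n.+1)%N ->
  addr n i j = addr n i' j' -> i = i' /\ j = j'.
Proof.
rewrite /addr => le_j le_j' eq_ij.
have := congr1 (divn^~ n.+2) eq_ij; rewrite !divnMDl ?divn_small //.
by move=> eq_i; split; [lia|move: eq_ij; rewrite (_ : i = i'); lia].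
Qed.

Lemma addr_bound i j : (i <= n)%N -> (j <= n.+1)%N -> (addr n i j < W)%N.
Proof. by rewrite /addr => le_i le_j; have := leq_mul le_i (leqnn n.+2); lia. Qed.

(** A finished entry refers only to finished ones, so writing at the next address disturbs none of
    them. Integer array 0 and the real arrays up to 3 hold scalars, input and weights, not table
    data. *)
Lemma filled_frame st st' i0 j0 : (j0 < n.+1)%N ->
  (forall arr p, (0 < arr)%N -> p != addr n i0 j0.+1 ->
     ints st' arr p = ints st arr p) ->
  (forall arr p, (3 < arr)%N -> p != addr n i0 j0.+1 ->
     reals st' arr p = reals st arr p) ->
  filled st i0 j0 -> filled st' i0 j0.
Proof.
move=> j0_n eq_i eq_r fill i j ij_n done_ij.
have ne i' j' : (i' < j' <= n.+1)%N -> (i0 < i')%N || (i' == i0) && (j' <= j0)%N ->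
    addr n i' j' != addr n i0 j0.+1.
  by move=> ij' done'; apply/eqP => /addr_inj[]; lia.
have [top_ij mass_ij] := fill i j ij_n done_ij.
rewrite /filled_entry /table_entry /costs !eq_i ?eq_r ?ne //.
case: eqVneq => [//|ne_j] [s [[s_ij best] F_ij m123 m45]].
split=> //; exists s; split=> //.
  split=> // s' s'_ij; rewrite !eq_r ?ne //; try lia.
  exact: best.
by rewrite F_ij !eq_r ?ne //; lia.
Qed.

Lemma massS i j : (i <= j)%N -> mass a b i j.+1 = mass a b i j + (a j + b j).
Proof. by move=> le_ij; rewrite /mass big_nat_recr. Qed.

Lemma filled_next st i j : filled st i j -> filled_entry st i j.+1 ->
  filled st i j.+1.
Proof.
move=> fill new i' j' ij_n; case: (eqVneq (i', j') (i, j.+1)) => [[-> ->] //|ne].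
move=> done_ij; apply: fill => //; case/orP: done_ij => [->//|/andP[/eqP eq_i le_j]].
have ne_j : j' != j.+1 by apply: contraNneq ne => ->; rewrite eq_i.
by lia.
Qed.

Lemma row_start_wp st m : (m <= n)%N -> weights_loaded st ->
  ints st 0%N 2%N = m.+1 -> filled st m.+1 n.+1 ->
  wp W row_start (fun st' => [/\ weights_loaded st', ints st' 0%N 2%N = m,
    ints st' 0%N 3%N = m.+1 & filled st' m m.+1]) st.
Proof.
move=> le_mn [n_st a_st b_st] i_st fill.
rewrite /= /set_cell /= !(n_st, i_st) subn1 addn1 addn2 /=.
rewrite -/(addr n m m.+1).
do 4?[split; first by lia]; split=> //.
apply: filled_next; last first.
  rewrite /filled_entry top1 /mass big_nat1 /table_entry /costs eqxx /=.
  by rewrite !eqxx /= subrr a_st ?b_st.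
apply: (@filled_frame st) => // [arr p arr0 /negPf ne|arr p arr0 /negPf ne|i j ij_n done_ij].
- by rewrite /= !ne !andbF (gtn_eqF arr0).
- by rewrite /= !ne !andbF.
(* Row [m] has no entry up to column [m], so only the complete rows count. *)
- by apply: fill => //; lia.
Qed.

Lemma entry_start_wp st i j : (i < j <= n)%N -> weights_loaded st ->
  ints st 0%N 2%N = i -> ints st 0%N 3%N = j -> filled st i j ->
  wp W entry_start (fun st' =>
    [/\ weights_loaded st', [/\ ints st' 0%N 2%N = i, ints st' 0%N 3%N = j.+1,
          ints st' 0%N 4%N = i.+2 & ints st' 0%N 5%N = i.+1],
        ints st' 6%N (addr n i j.+1) = top b i j.+1,
        reals st' 4%N (addr n i j.+1) = mass a b i j.+1 & filled st' i j]) st.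
Proof.
move=> ij_n [n_st a_st b_st] i_st j_st fill.
have [top_ij mass_ij _] := fill i j ltac:(lia) ltac:(lia).
have [|t_ij _ _] := @topP _ b i j; first by lia.
rewrite /= /set_cell /= !(n_st, i_st, j_st) subn1 !addn1 !addn2 /=.
rewrite -!/(addr n _ _) top_ij mass_ij !b_st ?a_st; try lia.
rewrite -massS; last by lia.
have frame f g : (forall arr p, (0 < arr)%N -> p != addr n i j.+1 ->
     f arr p = ints st arr p) ->
    (forall arr p, (3 < arr)%N -> p != addr n i j.+1 ->
     g arr p = reals st arr p) -> filled (State f g) i j.
  by move=> eq_f eq_g; apply: filled_frame fill => //; lia.
have nle_ji : (j <= i)%N = false by lia.
rewrite nle_ji !eqxx; split; first by lia.
case: leP => le_b; (do 3?[split; first by lia]); split=> //;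
  by apply: frame => arr p arr_gt /negPf ne /=; rewrite ne !andbF ?(gtn_eqF arr_gt).
Qed.

(** The loop invariant: [best_split] restricted to the splits below [u]; for [u = j] the two
    coincide. *)
Definition best_before (F : nat -> nat -> R) i j u s : Prop :=
  (i < s < u)%N /\ forall s', (i < s' < u)%N ->
    b (other b i s' j) <= b (other b i s j) /\
    (b (other b i s j) <= b (other b i s' j) ->
       F i s + F s j <= F i s' + F s' j).

(** The negation of [keep_best], with [u] as the candidate and [s] as the current split. *)
Definition improves (F : nat -> nat -> R) i j u s : bool :=
  ~~ ((b (other b i u j) <= b (other b i s j)) &&
      ~~ ((b (other b i s j) <= b (other b i u j)) &&
          ~~ (F i s + F s j <= F i u + F u j))).

(** The lexicographic order is transitive, so beating the current best means beating every earlier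
    split. *)
Lemma best_before_next F i j u s : best_before F i j u s ->
  best_before F i j u.+1 (if improves F i j u s then u else s).
Proof.
move=> [s_iu best]; rewrite /improves; case: ifP => [imp|not_imp].
  split=> [|s' s'_iu]; first by lia.
  case: (eqVneq s' u) => [->|ne]; first by [].
  have [|le_o le_F] := best s'; first by lia.
  move: imp; rewrite negb_and negbK -ltNge => /orP[lt_o|/andP[le_o']].
    split; first by apply: le_trans le_o (ltW lt_o).
    by move=> /(lt_le_trans lt_o); rewrite ltNge le_o.
  rewrite -ltNge => lt_F; split; first exact: le_trans le_o le_o'.
  by move=> le_us'; apply: le_trans (ltW lt_F) (le_F (le_trans le_o' le_us')).
split=> [|s' s'_iu]; first by lia.
case: (eqVneq s' u) => [->|ne]; last by apply: best; lia.
move/negbFE: not_imp => /andP[le_o]; rewrite negb_and negbK => /orP[nle|le_F].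
  by split=> // le; rewrite le in nle.
by split.
Qed.

Definition split_loop i j u st : Prop :=
  [/\ weights_loaded st, [/\ ints st 0%N 2%N = i, ints st 0%N 3%N = j.+1,
        ints st 0%N 4%N = u & best_before (costs st) i j.+1 u (ints st 0%N 5%N)],
      ints st 6%N (addr n i j.+1) = top b i j.+1,
      reals st 4%N (addr n i j.+1) = mass a b i j.+1 & filled st i j].

Lemma improve_split_wp st i j u : (i < u <= j)%N -> (j <= n)%N ->
  split_loop i j u st -> wp W improve_split (split_loop i j u.+1) st.
Proof.
move=> u_ij le_jn [load [i_st j_st s_st best]].
move def_s: (ints st 0%N 5%N) best => s best top_ij mass_ij fill.
have [n_st a_st b_st] := load; have [s_iu _] := best.
have topE s' : (i < s' < j.+1)%N -> ints st 6%N (addr n i s') = top b i s' /\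
    ints st 6%N (addr n s' j.+1) = top b s' j.+1.
  move=> s'_ij; have [-> _ _] := fill i s' ltac:(lia) ltac:(lia).
  by have [-> _ _] := fill s' j.+1 ltac:(lia) ltac:(lia).
have otherE s' : (i < s' < j.+1)%N -> (other b i s' j.+1 <= n)%N.
  move=> s'_ij; have [|] := @topP _ b i s'; first by lia.
  have [|] := @topP _ b s' j.+1; first by lia.
  by have := otherP b s'_ij; case: ltnP => _ [_ ->]; lia.
have [top1_s top2_s] := topE s ltac:(lia).
have [top1_u top2_u] := topE u ltac:(lia).
have keepE : beval st keep_best = ~~ improves (costs st) i j.+1 u s.
  rewrite /= !(n_st, i_st, j_st, s_st, def_s) !addn2 -!/(addr n _ _).
  rewrite top1_s top2_s top1_u top2_u top_ij -!/(other b i _ j.+1).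
  by rewrite !b_st ?otherE ?negbK //; lia.
have frame f : (forall arr p, (0 < arr)%N -> f arr p = ints st arr p) ->
    filled (State f (reals st)) i j.
  by move=> eq_f; apply: filled_frame fill => // arr p arr0 _; apply: eq_f.
have next := best_before_next best.
cbn [improve_split wp]; rewrite keepE.
case: (improves _ _ _ _ _) next => /= next; rewrite /set_cell /= !(s_st, i_st, j_st, def_s) addn1.
  do 2?[split; first by lia].
  by split=> //; apply: frame => -[].
split; first by lia.
by split; rewrite /= ?def_s //; apply: frame => -[].
Qed.

Lemma close_entry_wp st i j : (i < j <= n)%N -> split_loop i j j.+1 st ->
  wp W close_entry (fun st' => [/\ weights_loaded st', ints st' 0%N 2%N = i,
    ints st' 0%N 3%N = j.+1 & filled st' i j.+1]) st.
Proof.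
move=> ij_n [load [i_st j_st s_st best]].
move def_s: (ints st 0%N 5%N) best => s best top_ij mass_ij fill.
have [n_st a_st b_st] := load; have [s_ij max_s] := best.
have [top_s _ _] := fill i s ltac:(lia) ltac:(lia).
have [top_s' _ _] := fill s j.+1 ltac:(lia) ltac:(lia).
have [|t_ij _ _] := @topP _ b i j.+1; first by lia.
have [|t1 _ _] := @topP _ b i s; first by lia.
have [|t2 _ _] := @topP _ b s j.+1; first by lia.
have other_n : (other b i s j.+1 <= n)%N.
  by have := otherP b s_ij; case: ltnP => _ [_ ->]; lia.
have bnd1 := @addr_bound i s ltac:(lia) ltac:(lia).
have bnd2 := @addr_bound s j.+1 ltac:(lia) ltac:(lia).
rewrite /= /set_cell /= !(n_st, i_st, j_st, def_s) !subn1 !addn2 /=.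
rewrite -!/(addr n _ _) top_s top_s' top_ij -!/(other b i s j.+1) b_st; last by lia.
do 5?[split; first by lia]; split=> //.
set st' := State _ _.
have eq_i arr p : (0 < arr)%N -> p != addr n i j.+1 -> ints st' arr p = ints st arr p.
  by move=> arr_gt /negPf ne; rewrite /= ne !andbF.
have eq_r arr p : (3 < arr)%N -> p != addr n i j.+1 -> reals st' arr p = reals st arr p.
  by move=> arr_gt /negPf ne; rewrite /= ne !andbF.
have fill' : filled st' i j by apply: filled_frame eq_i eq_r fill; lia.
(* The new address differs from those of both halves of any split, so the costs compared in the loop
   survive the write. *)
have costsE s' : (i < s' < j.+1)%N ->
    costs st' i s' = costs st i s' /\ costs st' s' j.+1 = costs st s' j.+1.
  by move=> s'_ij; rewrite /costs !eq_r //; apply/eqP => /addr_inj[]; lia.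
have [costs1 costs2] := costsE s s_ij.
apply: filled_next => //.
rewrite /filled_entry /table_entry [j.+1 == i.+1](_ : _ = false); last by lia.
split; [by []|by []|exists s; split].
- split=> // s' s'_ij; have [-> ->] := costsE s' s'_ij; rewrite costs1 costs2.
  exact: max_s.
- by rewrite costs1 costs2 /costs /st' /= eqxx mass_ij.
- by rewrite /st' /= eqxx.
- by rewrite /st' /= eqxx.
Qed.

Definition split_loop_time : nat :=
  (btime (BNot (BLeI var_j var_s)) + straight_time improve_split).+1.

Definition fill_entry_time : nat :=
  (straight_time entry_start +
   (n.+1 * split_loop_time + straight_time close_entry))%N.

Definition fill_row_time : nat :=
  (straight_time row_start +
   n.+1 * (btime (BLeI var_j var_n) + fill_entry_time).+1)%N.

Definition fill_table_time : nat :=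
  (n.+2 * (btime (BLeI (IConst 1) var_i) + fill_row_time).+1)%N.

Lemma fill_entry_runs st i j : (i < j <= n)%N -> weights_loaded st ->
  ints st 0%N 2%N = i -> ints st 0%N 3%N = j -> filled st i j ->
  runs W fill_entry st fill_entry_time (fun st' => [/\ weights_loaded st',
    ints st' 0%N 2%N = i, ints st' 0%N 3%N = j.+1 & filled st' i j.+1]).
Proof.
move=> ij_n load i_st j_st fill; apply: runs_seq.
apply: runs_mono (wp_runs (entry_start_wp ij_n load i_st j_st fill)) _ _ => //.
move=> {load i_st j_st fill}st [load [i_st j_st s_st best_st] top_ij mass_ij fill].
apply: runs_seq.
pose I r st := exists2 u, (u + r = j.+1)%N & split_loop i j u st.
apply: (@runs_mono _ _ _ _ _ _ (I 0%N)); 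
  first apply: (runs_while (t := straight_time improve_split)) (j.+1 - i.+2)%N _ _.
- move=> r {load i_st j_st s_st best_st top_ij mass_ij fill}st [u def_u loop].
  have [_ [i_st j_st s_st [best _]] _ _ _] := loop.
  split; first by rewrite /= s_st j_st; lia.
  apply: runs_mono (wp_runs (improve_split_wp _ _ loop)) _ _ => //; try lia.
  by move=> st' loop'; exists u.+1 => //; lia.
- by move=> st' [u def_u [_ [_ j_st' s_st' _] _ _ _]]; rewrite /= s_st' j_st'; lia.
(* Only split [i.+1] precedes [i.+2], so it is trivially the best so far. *)
- exists i.+2; first by lia.
  split=> //; split=> //; rewrite best_st; split=> [|s' s'_ij]; first by lia.
  by rewrite (_ : s' = i.+1) //; lia.
- by apply: leq_mul => //; lia.
move=> st' [u]; rewrite addn0 => -> /(close_entry_wp ij_n).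
exact: wp_runs.
Qed.

Lemma fill_row_runs st m : (m <= n)%N -> weights_loaded st ->
  ints st 0%N 2%N = m.+1 -> filled st m.+1 n.+1 ->
  runs W fill_row st fill_row_time (fun st' => [/\ weights_loaded st',
    ints st' 0%N 2%N = m & filled st' m n.+1]).
Proof.
move=> le_mn load i_st fill; apply: runs_seq.
apply: runs_mono (wp_runs (row_start_wp le_mn load i_st fill)) _ _ => //.
move=> {load i_st fill}st [load i_st j_st fill].
pose I r st := [/\ weights_loaded st, ints st 0%N 2%N = m &
  exists j, [/\ (j + r = n.+1)%N, (m < j)%N, ints st 0%N 3%N = j & filled st m j]].
apply: (@runs_mono _ _ _ _ _ _ (I 0%N)); 
  first apply: (runs_while (t := fill_entry_time)) (n.+1 - m.+1)%N _ _.
- move=> r {load i_st j_st fill}st [load i_st [j [def_j lt_mj j_st fill]]].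
  have [n_st _ _] := load; split; first by rewrite /= n_st j_st; lia.
  apply: runs_mono (fill_entry_runs _ load i_st j_st fill) _ _ => //; first by lia.
  move=> st' [load' i_st' j_st' fill']; split=> //; exists j.+1; split=> //; lia.
- move=> st' [[n_st _ _] _ [j [def_j _ j_st' _]]].
  by rewrite /= n_st j_st'; lia.
- by split=> //; exists m.+1; split=> //; lia.
- by apply: leq_mul => //; lia.
by move=> st' [load' i_st' [j []]]; rewrite addn0 => -> _ _ fill'.
Qed.

Lemma fill_table_runs st : weights_loaded st -> ints st 0%N 2%N = n.+1 ->
  runs W (While (BLeI (IConst 1) var_i) fill_row) st fill_table_time
    (fun st' => weights_loaded st' /\ filled st' 0 n.+1).
Proof.
move=> load i_st.
pose I r st := [/\ weights_loaded st, ints st 0%N 2%N = r, (r <= n.+1)%N &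
  filled st r n.+1].
apply: (@runs_mono _ _ _ _ _ _ (I 0%N)); 
  first apply: (runs_while (t := fill_row_time)) n.+1 _ _.
- move=> r {load i_st}st [load i_st le_rn fill].
  split; first by rewrite /= i_st.
  apply: runs_mono (fill_row_runs _ load i_st fill) _ _ => //.
  by move=> st' [load' i_st' fill']; split=> //; lia.
- by move=> st' [_ i_st' _ _]; rewrite /= i_st'.
(* No interval starts at [n.+1] or later, so nothing is claimed yet. *)
- by split=> // i j; lia.
- by [].
by move=> st' [load' _ _ fill'].
Qed.

Context (beta : nat -> R).
Hypothesis b_succ : forall k, b k.+1 = beta k.
Hypothesis b_zero : b 0 = \sum_(0 <= k < n) beta k.

Definition shift_time : nat :=
  (n.+1 * (btime (BNot (BLeI var_n var_i)) + straight_time shift_weight).+1)%N.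

Lemma shift_weights_runs st : ints st 0%N 0%N = n -> ints st 0%N 2%N = 0%N ->
  (forall k, (k <= n)%N -> reals st 1%N k = a k) ->
  (forall k, (k < n)%N -> reals st 2%N k = beta k) -> reals st 3%N 0%N = 0 ->
  runs W shift_weights st shift_time
    (fun st' => weights_loaded st' /\ ints st' 0%N 2%N = n).
Proof.
move=> n_st i_st a_st beta_st b0_st.
pose I r st := exists k, [/\ (k + r = n)%N,
  [/\ ints st 0%N 0%N = n, ints st 0%N 2%N = k,
    forall k', (k' <= n)%N -> reals st 1%N k' = a k'
    & forall k', (k' < n)%N -> reals st 2%N k' = beta k'],
  reals st 3%N 0%N = \sum_(0 <= k' < k) beta k' &
  forall k', (k' < k)%N -> reals st 3%N k'.+1 = beta k'].
apply: (@runs_mono _ _ _ _ _ _ (I 0%N)); 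
  first apply: (runs_while (t := straight_time shift_weight)) n _ _.
- move=> r {n_st i_st a_st beta_st b0_st}st.
  move=> [k [def_k [n_st i_st a_st beta_st] b0_st b_st]].
  split; first by rewrite /= n_st i_st; lia.
  apply: wp_runs; rewrite /= /set_cell /= !i_st addn1; split; first by lia.
  exists k.+1; split=> //=; first by lia.
    by rewrite big_nat_recr //= b0_st beta_st //; lia.
  move=> k' k'_k; rewrite eqSS; case: eqVneq => [->|ne]; first by rewrite beta_st //; lia.
  by apply: b_st; lia.
- by move=> st' [k [def_k [n_st' i_st' _ _] _ _]]; rewrite /= n_st' i_st'; lia.
- by exists 0%N; split=> //; rewrite big_geq.
- by [].
move=> st' [k []]; rewrite addn0 => -> [n_st' i_st' a_st' _] b0_st' b_st'.
split=> //; split=> // -[_|k' k'_n]; first by rewrite b_zero.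
by rewrite b_succ b_st'.
Qed.

Definition program_time : nat :=
  (shift_time + (straight_time (ISet 0 (IConst 2) (isucc var_i)) +
    (fill_table_time + straight_time (ISet 0 (IConst 1) (isucc var_n)))))%N.

Lemma split_tree_program_runs st : ints st 0%N 0%N = n -> ints st 0%N 2%N = 0%N ->
  (forall k, (k <= n)%N -> reals st 1%N k = a k) ->
  (forall k, (k < n)%N -> reals st 2%N k = beta k) -> reals st 3%N 0%N = 0 ->
  runs W split_tree_program st program_time
    (fun st' => ints st' 0%N 1%N = addr n 0 n.+1 /\
       forall i j, (i < j <= n.+1)%N -> table_entry n a b (ints st') (costs st') i j).
Proof.
move=> n_st i_st a_st beta_st b0_st; apply: runs_seq.
apply: runs_mono (shift_weights_runs n_st i_st a_st beta_st b0_st) _ _ => //.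
move=> {n_st i_st a_st beta_st b0_st}st [load i_st]; apply: runs_seq; apply: wp_runs.
rewrite /= i_st addn1; split; first by lia.
apply: runs_seq.
apply: runs_mono (fill_table_runs _ _) _ _ => // {load i_st}st [load fill].
apply: wp_runs => /=; have [n_st _ _] := load.
rewrite n_st addn1; split; first by lia.
split=> // i j ij_n.
by have [_ _] := fill i j ij_n ltac:(lia).
Qed.

End Program.

(** Three nested loops take cubic time, which [n ^ 4] dominates. The factors 2 and 3 in the constant
    come from [n.+1 <= 2 * n] and [n.+2 <= 3 * n] for [0 < n]. *)
Lemma program_time_bound : exists C, forall n, (0 < n)%N -> (program_time n <= C * n ^ 4)%N.
Proof.
exists ((btime (BNot (BLeI var_n var_i)) + straight_time shift_weight).+1 * 2 +
  straight_time (ISet 0 (IConst 2) (isucc var_i)) +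
  straight_time (ISet 0 (IConst 1) (isucc var_n)) +
  3 * ((btime (BLeI (IConst 1) var_i) + straight_time row_start +
   2 * (btime (BLeI var_j var_n) + straight_time entry_start +
     straight_time close_entry + 2 * split_loop_time).+1).+1))%N => n n_gt0.
rewrite /program_time /shift_time /fill_table_time /fill_row_time /fill_entry_time.
move: (btime _ + straight_time shift_weight)%N (straight_time (ISet 0 _ (isucc var_i)))
  (straight_time (ISet 0 _ (isucc var_n))) (btime (BLeI (IConst 1) var_i))
  (straight_time row_start) (btime (BLeI var_j var_n)) (straight_time entry_start)
  (straight_time close_entry) split_loop_time => c1 c2 c3 c4 c5 c6 c7 c8 c9.
set e := (c6 + c7 + c8 + 2 * c9).+1; set r := (c4 + c5 + 2 * e).+1.
have le_e : ((c6 + (c7 + (n.+1 * c9 + c8))).+1 <= n * e)%N by rewrite /e; nia.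
have le_r : ((c4 + (c5 + n.+1 * (c6 + (c7 + (n.+1 * c9 + c8))).+1)).+1 <=
    n * n * r)%N.
  have : (n.+1 * (c6 + (c7 + (n.+1 * c9 + c8))).+1 <= n * n * (2 * e))%N.
    rewrite (_ : n * n * (2 * e) = (2 * n) * (n * e))%N; last by lia.
    by apply: leq_mul => //; lia.
  by rewrite /r; nia.
have le_t : (n.+2 * (c4 + (c5 + n.+1 * (c6 + (c7 + (n.+1 * c9 + c8))).+1)).+1 <=
    n ^ 3 * (3 * r))%N.
  rewrite (_ : n ^ 3 * (3 * r) = (3 * n) * (n * n * r))%N; last by lia.
  by apply: leq_mul => //; lia.
have le_n1 : (n <= n ^ 4)%N by rewrite -{1}[n]expn1 leq_pexp2l.
have le_n3 : (n ^ 3 * (3 * r) <= n ^ 4 * (3 * r))%N.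
  by rewrite leq_mul2r leq_pexp2l ?orbT.
have le_1 : (n.+1 * c1.+1 <= n ^ 4 * (c1.+1 * 2))%N.
  rewrite (mulnC c1.+1) mulnA; apply: leq_mul => //; lia.
have le_23 : (c2 + c3 <= n ^ 4 * (c2 + c3))%N.
  by rewrite leq_pmull // expn_gt0 n_gt0.
by rewrite mulnC; move: le_t le_n3 le_1 le_23; rewrite !mulnDr; lia.
Qed.

(** * Optimality of the computed tree *)

Section Optimality.
Local Open Scope ring_scope.
Context {R : realType} (n : nat) (K : 'I_n -> R).
Context (alpha : 'I_n.+1 -> R) (beta : 'I_n -> R).

(* The virtual key 0 stands for the key removed above the root.  Its weight is
   only required to dominate all others. *)
Definition shifted_weight (k : nat) : R :=
  if k is k'.+1 then input_array beta k' else \sum_(0 <= k < n) input_array beta k.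

Lemma input_arrayE m (f : 'I_m -> R) (k : 'I_m) : input_array f k = f k.
Proof. by rewrite /input_array valK. Qed.

Lemma shifted_weight_max : (forall k, 0 <= beta k) ->
  forall k, (k <= n)%N -> shifted_weight k <= shifted_weight 0.
Proof.
move=> beta_ge0 [//|k] k_n; rewrite /shifted_weight big_mkord.
rewrite (bigD1 (Ordinal k_n)) //= lerDl sumr_ge0 // => i _.
by rewrite input_arrayE; apply: beta_ge0.
Qed.

Context (d : measure_display) (Omega : measurableType d).
Context (P : probability Omega R) (V : {RV P >-> R}).
Hypothesis inst : bst_instance K alpha beta V.

Let a : nat -> R := input_array alpha.
Let b : nat -> R := shifted_weight.

Lemma weight_ge0 k : 0 <= beta k.
Proof. by have [_ _ P_key _] := inst; rewrite -lee_fin -P_key measure_ge0. Qed.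

Lemma cost_span_cost (T : split_tree n) : spans b 0 n.+1 0 T ->
  cost K V T = (span_cost a b 0 n.+1 T)%:E.
Proof.
have [_ K_mono P_key P_gap] := inst => span_T.
rewrite (cost_weighted_visits K_mono P_key P_gap); congr EFin.
apply: (weighted_visits_spans K_mono _ _ (in_play_predT _) _ _ _ _ span_T) => //.
- by move=> g; apply: input_arrayE.
- by move=> k; apply: input_arrayE.
- by move=> k k_n; apply: shifted_weight_max => //; apply: weight_ge0.
Qed.

(** The stored tree costs exactly [F 0 n.+1], and this is a lower bound for every valid tree. *)
Lemma table_optimal (m : nat -> nat -> nat) (F : nat -> nat -> R) :
  (forall i j, (i < j <= n.+1)%N -> table_entry n a b m F i j) ->
  exists T : split_tree n, tree_at m (addr n 0 n.+1) T /\ optimal K beta V T.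
Proof.
move=> table; have [n_gt0 K_mono P_key P_gap] := inst.
have b_max := shifted_weight_max weight_ge0.
have b_beta (k : 'I_n) : b k.+1 = beta k by apply: input_arrayE.
have [T [mem_T]] := @table_tree _ n a b b_max m F table 0 n.+1 ltac:(lia).
rewrite (top0 b_max) ?ltn0Sn ?leqnn // => span_T cost_T; exists T; split=> //.
have bstE T' := binary_split_tree_spans K_mono b_beta T'.
split=> [|T' /bstE span_T']; first exact/bstE.
rewrite !cost_span_cost // lee_fin cost_T.
apply: (@span_cost_ge _ a b F n.+1) span_T' _ _ _ => // [i i_n|i j ij_n].
  have := table i i.+1; rewrite /table_entry eqxx => -[] //; lia.
have := table i j ltac:(lia); rewrite /table_entry.
case: eqVneq => [eq_j|_ [s [best_s F_ij _ _]]]; first by lia.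
by exists s.
Qed.

End Optimality.

Theorem theorem3 (R : realType) :
  exists (prog : cmd) (c C : nat),
    forall (n : nat) (K : 'I_n -> R) (alpha : 'I_n.+1 -> R) (beta : 'I_n -> R)
      (d : measure_display) (Omega : measurableType d)
      (P : probability Omega R) (V : {RV P >-> R}),
      bst_instance K alpha beta V ->
      exists (t : nat) (st : state R) (T : split_tree n),
        [/\ exec (n.+1 ^ c) prog (input K alpha beta) t st,
            (t <= C * n ^ 4)%N,
            outputs st T
          & optimal K beta V T].
Proof.
have [C le_C] := program_time_bound.
(* Table addresses stay below [n.+1 * n.+2]; the fourth power of [n.+1] leaves room for them and for
   the slack in [W_large]. *)
exists split_tree_program, 4, C => n K alpha beta d Omega P V inst.
have [n_gt0 _ _ _] := inst.
have W_large : n.+1 * n.+2 + 2 <= n.+1 ^ 4.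
  have : n.+1 * n.+2 <= n.+1 ^ 3.
    by rewrite (expnS _ 2) leq_mul2l /= expnS expn1; nia.
  have : 2 * n.+1 ^ 3 <= n.+1 ^ 4 by rewrite (expnS _ 3) leq_mul2r; lia.
  have : 2 <= n.+1 ^ 3 by rewrite -[X in X <= _]expn1; lia.
  lia.
have [t [st [ex le_t [root table]]]] :=
  @split_tree_program_runs R _ n (input_array alpha) (shifted_weight beta) W_large
    (input_array beta) (fun=> erefl) erefl (input K alpha beta)
    erefl erefl (fun _ _ => erefl) (fun _ _ => erefl) erefl.
have [T [mem_T opt_T]] := table_optimal inst table.
exists t, st, T; split=> //; first exact: leq_trans le_t (le_C n n_gt0).
by rewrite /outputs root.
Qed.
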